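(* Let $d,e\in\mathbb{N}\setminus\{0\}$ and $\alpha,\beta\in[1,+\infty[$ with $(d,\alpha)\neq(e,\beta)$, satisfying one of the following three conditions: (1) $\alpha$ and $\beta$ are multiplicatively independent; (2) $\alpha,\beta>1$ and $d\neq e$; (3) $(\alpha,\beta)\neq(1,1)$ and, either $\beta=1$ and $e\neq0$, or $\alpha=1$ and $d\neq0$. Let $C$ be a finite alphabet. If $x\in C^{\mathbb{N}}$ is both $(d,\alpha)$-substitutive and $(e,\beta)$-substitutive, then every letter of $C$ having infinitely many occurrences in $x$ appears in $x$ with bounded gaps (i.e., the differences between consecutive occurrences of that letter are bounded).
   Context: A substitution is a morphism $\sigma:A\to A^*$ on a finite alphabet such that some letter $a$ satisfies $|\sigma^n(a)|\to\infty$ and $\sigma(a)=au$ for some word $u$. A fixed point $y$ of $\sigma$ is proper if every letter of $A$ occurs in $y$. For a non-erasing substitution, each letter $a$ has a growth type $(d(a),\alpha(a))\in\mathbb{N}\times[1,\infty)$: $|\sigma^n(a)|$ is bounded above and below by positive constant multiples of $n^{d(a)}\alpha(a)^n$ for all large $n$ (for a suitable power of $\sigma$, $|\sigma^n(a)|\sim c(a)n^{d(a)}\alpha(a)^n$). Growth types are ordered by $(d,\alpha)<(d',\alpha')$ iff $\alpha<\alpha'$, or $\alpha=\alpha'$ and $d<d'$. The growth type of $\sigma$ is $(D,\Theta)$ where $\Theta=\max_a\alpha(a)$ and $D=\max\{d(a):\alpha(a)=\Theta\}$ (these are well defined up to replacing $\sigma$ by a power, which does not change fixed points). A sequence $x\in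 C^{\mathbb{N}}$ is $(D,\Theta)$-substitutive if $x=\phi(y)$ where $y$ is a proper fixed point of a substitution of growth type $(D,\Theta)$ and $\phi$ is a letter-to-letter morphism (it maps letters to letters). Reals $\alpha,\beta\ge1$ are multiplicatively independent if $\alpha^k=\beta^\ell$ with $k,\ell\in\mathbb{N}$ implies $k=0$ or $\ell=0$. *)

(* Defs.v *)
From HB Require Import structures.
From mathcomp Require Import all_boot all_order all_algebra.
From mathcomp Require Import all_classical all_reals all_analysis.

Set Implicit Arguments.
Unset Strict Implicit.
Unset Printing Implicit Defensive.

Import Order.TTheory GRing.Theory Num.Theory.
Import numFieldNormedType.Exports.

Local Open Scope classical_set_scope.
Local Open Scope ring_scope.

(* A morphism A^* -> B^* is given by its values f : A -> seq B on letters;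
   [morph f] is its extension to words.  Infinite words are functions on nat,
   and [mkseq y n] is the prefix of length n of y. *)
Definition morph (A B : Type) (f : A -> seq B) (w : seq A) : seq B :=
  flatten (map f w).

Definition nonerasing (A B : Type) (f : A -> seq B) : Prop :=
  forall a, f a <> [::].

Definition substitution (A : finType) (sigma : A -> seq A) : Prop :=
  exists a : A,
    (exists u : seq A, sigma a = a :: u) /\
    size (iter n (morph sigma) [:: a]) @[n --> \oo] --> \oo.

(* z is the infinite word f(y_0) f(y_1) f(y_2) ...; the length condition says
   that this concatenation is indeed infinite (it is automatic if f is
   non-erasing). *)
Definition infinite_image (A B : Type) (f : A -> seq B)
    (y : nat -> A) (z : nat -> B) : Prop :=
  (forall n, morph f (mkseq y n) = mkseq z (size (morph f (mkseq y n)))) /\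
  size (morph f (mkseq y n)) @[n --> \oo] --> \oo.

Definition fixed_point (A : Type) (sigma : A -> seq A) (y : nat -> A) : Prop :=
  infinite_image sigma y y.

Definition proper (A : Type) (y : nat -> A) : Prop :=
  forall a, exists n, y n = a.

Definition letter_growth_type (R : realType) (A : finType)
    (sigma : A -> seq A) (a : A) (d : nat) (alpha : R) : Prop :=
  1 <= alpha /\
  exists c1 c2 : R, [/\ 0 < c1, 0 < c2 &
    \forall n \near \oo,
      c1 * (n%:R ^+ d * alpha ^+ n)
        <= (size (iter n (morph sigma) [:: a]))%:R
        <= c2 * (n%:R ^+ d * alpha ^+ n)].

(* Theta = max_a alpha(a) and D = max {d(a) | alpha(a) = Theta}.  The type
   (d(a), alpha(a)) is uniquely determined by [letter_growth_type]. *)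
Definition growth_type (R : realType) (A : finType)
    (sigma : A -> seq A) (D : nat) (Theta : R) : Prop :=
  exists (d : A -> nat) (alpha : A -> R),
    [/\ forall a, letter_growth_type sigma a (d a) (alpha a),
        forall a, alpha a <= Theta,
        forall a, alpha a = Theta -> (d a <= D)%N
      & exists a, alpha a = Theta /\ d a = D].

(* Growth types are only considered for non-erasing substitutions. *)
Definition substitutive (R : realType) (C : finType)
    (D : nat) (Theta : R) (x : nat -> C) : Prop :=
  exists (A : finType) (sigma : A -> seq A) (y : nat -> A) (phi : A -> C),
    [/\ substitution sigma,
        nonerasing sigma,
        growth_type sigma D Theta,
        fixed_point sigma y /\ proper y
      & forall n, x n = phi (y n)].

Definition mult_independent (R : realType) (alpha beta : R) : Prop :=
  forall k l : nat, alpha ^+ k = beta ^+ l -> k = 0%N \/ l = 0%N.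

Definition consecutive_occurrences (C : Type) (x : nat -> C) (c : C)
    (i j : nat) : Prop :=
  [/\ (i < j)%N, x i = c, x j = c
    & forall k, (i < k < j)%N -> x k <> c].

Definition bounded_gaps (C : Type) (x : nat -> C) (c : C) : Prop :=
  exists g : nat, forall i j,
    consecutive_occurrences x c i j -> (j - i <= g)%N.

(* Main.v *)
(* Suppose that [c] has infinitely many occurrences in [x] and unbounded gaps, and
   call a record a position where a gap opens that is longer than all earlier
   gaps; the set of records depends on [x] only.  If [x] is the image of a fixed
   point of a substitution [s] of growth type (D, Theta), then, by minimality, the
   gap of a record lies in the n-th image of a factor taken from a finite list, at
   its first occurrence.  Hence, for a power of [s], the records are among finitely
   many sequences asymptotic to gamma n^D Theta^n (or, if Theta = 1, successive
   records have quotients tending to 1), and successive records have bounded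
   quotients because the gaps given by such a factor, if unbounded in n, keep
   growing within a bounded number of steps.  On the logarithmic scale the records
   of an exponential substitution stay close to finitely many curves
   n ln Theta + D ln n + const, and the pigeonhole principle shows that two such
   descriptions are compatible only if the two growth rates are multiplicatively
   dependent and the two degrees are equal; similarly the quotients of successive
   records cannot tend to 1 if one of the two substitutions is exponential.

   The asymptotics |s^n(a)| ~ c(a) n^d(a) alpha(a)^n are proved by induction on
   d(a): a positive eigenvector turns the restriction of the incidence matrix to
   the letters of a given type into a stochastic matrix, whose powers converge if
   [s] is replaced by a suitable power, and Stolz-Cesaro sums the contribution of
   the letters of smaller type. *)
Require Import Defs.
From HB Require Import structures.
From mathcomp Require Import all_boot all_order all_algebra.
From mathcomp Require Import all_classical all_reals all_analysis.
From mathcomp Require Import zify ring lra.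

Set Implicit Arguments.
Unset Strict Implicit.
Unset Printing Implicit Defensive.

Import Order.TTheory GRing.Theory Num.Theory.
Import numFieldNormedType.Exports.

Local Open Scope classical_set_scope.
Local Open Scope ring_scope.

(** * Morphisms *)

(** One power of the substitution removes two periodicity obstacles: [p] is such that the images of
    order [p] and [2p] of each letter have the same letters. Then occurrence in an image is
    transitive, so the stochastic matrices have no periodic class, and whether the image of a letter
    contains the observed letter no longer changes under iteration, so gaps can be followed from
    image to image. A gap in an image also depends on the letters bounding it; marking these letters
    makes the passage to images a genuine morphism on gaps.

    The exponents [n] of the two substitutions are unrelated, so both descriptions are rewritten in
    terms of the record [t] alone: [ln t] being equivalent to [n ln Theta], the term [D ln n]
    becomes [D ln (ln t)] up to a constant. Over bounded ranges of [ln t] this term is almost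
    constant, which isolates the rates; over long ranges [ln (ln t)] comes close to every large
    real, which isolates the degrees. Both uses rest on the bounded quotients of successive
    records. *)

Section Morphisms.
Local Open Scope nat_scope.
Variables (A : Type) (s : A -> seq A).

Lemma morph_cat (B : Type) (f : A -> seq B) w1 w2 :
  morph f (w1 ++ w2) = morph f w1 ++ morph f w2.
Proof. by rewrite /morph map_cat flatten_cat. Qed.

Lemma morph_cons (B : Type) (f : A -> seq B) a w :
  morph f (a :: w) = f a ++ morph f w.
Proof. by []. Qed.

Lemma morph_seq1 (B : Type) (f : A -> seq B) a : morph f [:: a] = f a.
Proof. by rewrite /morph /= cats0. Qed.

Lemma size_morph (B : Type) (f : A -> seq B) w :
  size (morph f w) = \sum_(a <- w) size (f a).
Proof.
elim: w => [|a w IH]; first by rewrite big_nil.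
by rewrite morph_cons size_cat IH big_cons.
Qed.

Lemma iter_morph_nil n : iter n (morph s) [::] = [::].
Proof. by elim: n => //= n ->. Qed.

Lemma iter_morph_cat n w1 w2 :
  iter n (morph s) (w1 ++ w2) = iter n (morph s) w1 ++ iter n (morph s) w2.
Proof. by elim: n => //= n ->; rewrite morph_cat. Qed.

Lemma iter_morph_cons n a w :
  iter n (morph s) (a :: w) = iter n (morph s) [:: a] ++ iter n (morph s) w.
Proof. by rewrite -cat1s iter_morph_cat. Qed.

Lemma iter_morphE n w :
  iter n (morph s) w = morph (fun a => iter n (morph s) [:: a]) w.
Proof.
elim: w => [|a w IH]; first by rewrite iter_morph_nil.
by rewrite iter_morph_cons IH.
Qed.

Lemma iter_morphS n a :
  iter n.+1 (morph s) [:: a] = iter n (morph s) (s a).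
Proof. by rewrite iterSr morph_seq1. Qed.

Lemma size_iter_morph n w :
  size (iter n (morph s) w) = \sum_(a <- w) size (iter n (morph s) [:: a]).
Proof. by rewrite iter_morphE size_morph. Qed.

Lemma size_iter_morphS n a :
  size (iter n.+1 (morph s) [:: a]) =
  \sum_(b <- s a) size (iter n (morph s) [:: b]).
Proof. by rewrite iter_morphS size_iter_morph. Qed.

Hypothesis hne : nonerasing s.

Lemma nonerasing_gt0 a : 0 < size (s a).
Proof. by case E: (s a) => //; have := hne E. Qed.

Lemma size_morph_ge w : size w <= size (morph s w).
Proof.
rewrite size_morph; elim: w => [|a w IH] //=.
by rewrite big_cons; have := nonerasing_gt0 a; lia.
Qed.

Lemma size_iter_morph_mono m n w : m <= n ->
  size (iter m (morph s) w) <= size (iter n (morph s) w).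
Proof.
move=> /subnK <-; elim: (n - m) => // k IH.
by rewrite addSn iterS; apply: leq_trans IH (size_morph_ge _).
Qed.

Lemma size_iter_morph_ge n w : size w <= size (iter n (morph s) w).
Proof. exact: (size_iter_morph_mono w (leq0n n)). Qed.

Lemma nonerasing_iter n : nonerasing (fun a => iter n (morph s) [:: a]).
Proof. by move=> a /(congr1 size); have := size_iter_morph_ge n [:: a]; rewrite /=; lia. Qed.

End Morphisms.

(** * Letters and words that stop growing under a non-erasing morphism *)

Section MorphismGrowth.
Local Open Scope nat_scope.
Variables (B : finType) (mu : B -> seq B).
Hypothesis hne : nonerasing mu.

(** The [n]-th iterate of [grow] from the empty set is the set of letters whose [n]-th image has
    length at least 2. Being monotone, [grow] reaches its fixed point within [#|B|] steps, so a
    letter not expanded by then never is. *)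
Let grow (X : {set B}) : {set B} :=
  [set e | (1 < size (mu e)) || has (fun b => b \in X) (mu e)]%SET.

Let grow_mono : {homo grow : X Y / X \subset Y}.
Proof.
move=> X Y XY; apply/fintype.subsetP => e; rewrite !inE => /orP[->//|/hasP[b be bX]].
by apply/orP; right; apply/hasP; exists b => //; apply: (fintype.subsetP XY).
Qed.

Let growP n : iter n grow finset.set0 = [set e | 1 < size (iter n (morph mu) [:: e])]%SET.
Proof.
elim: n => [|n IH]; first by apply/setP => e; rewrite !inE.
rewrite iterS IH; apply/setP => e; rewrite !inE iter_morphS.
have := nonerasing_gt0 hne e; case E : (mu e) => [//|b [|b' w]] _ /=.
  by rewrite inE orbF.
rewrite iter_morph_cons size_cat (iter_morph_cons _ _ b') size_cat.
have := size_iter_morph_ge hne n [:: b]; have := size_iter_morph_ge hne n [:: b'].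
rewrite /=; lia.
Qed.

Lemma stable_letter e n : size (iter #|B| (morph mu) [:: e]) = 1 ->
  size (iter n (morph mu) [:: e]) = 1.
Proof.
move=> he; have sub : iter n grow finset.set0 \subset iter #|B| grow finset.set0.
  elim: n => [|n IH]; first exact: finset.sub0set.
  have -> : iter #|B| grow finset.set0 = grow (iter #|B| grow finset.set0).
    by have := fixsetK grow_mono; rewrite /fixset.
  by rewrite iterS; apply: grow_mono.
move: sub; rewrite !growP => /fintype.subsetP/(_ e); rewrite !inE he => H.
apply/eqP; rewrite eqn_leq (size_iter_morph_ge hne n [:: e]) andbT leqNgt.
by apply/negP => /H.
Qed.

(** Every letter contributes at least 1 to the length, so a stall over [#|B|] steps leaves each
    letter with an image of length 1, and by [stable_letter] this persists. *)
Lemma stalled_word n m w : n <= m ->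
  size (iter (n + #|B|) (morph mu) w) = size (iter n (morph mu) w) ->
  size (iter m (morph mu) w) = size (iter n (morph mu) w).
Proof.
move=> /subnK <-; rewrite [n + #|B|]addnC !iterD.
set v := iter n (morph mu) w; set k := m - n => E.
suff : forall e, e \in v -> size (iter #|B| (morph mu) [:: e]) = 1.
  move=> H; rewrite size_iter_morph -[RHS]sum1_size !big_seq.
  by apply: eq_bigr => e /H/stable_letter.
move: E; rewrite size_iter_morph -sum1_size => E e ev.
have : \sum_(a <- v) (size (iter #|B| (morph mu) [:: a]) - 1) = 0.
  rewrite sumnB; first by rewrite E subnn.
  by move=> a _; exact: (size_iter_morph_ge hne #|B| [:: a]).
move/eqP; rewrite sum_nat_seq_eq0 => /allP/(_ e ev) /=.
have := size_iter_morph_ge hne #|B| [:: e]; rewrite /=; lia.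
Qed.

End MorphismGrowth.

(** * Fixed points *)

Section LastPosition.
Local Open Scope nat_scope.
Variables (A : Type) (P : pred A).

(* One more than the position of the last letter of [w] satisfying [P], and 0
   when there is none. *)
Definition last_pos (w : seq A) : nat := size w - find P (rev w).

Lemma last_pos_cat w1 w2 : last_pos (w1 ++ w2) =
  if has P w2 then size w1 + last_pos w2 else last_pos w1.
Proof.
rewrite /last_pos rev_cat find_cat has_rev size_cat !size_rev.
case: ifP => [h|_]; last lia.
by have := find_size P (rev w2); rewrite size_rev; lia.
Qed.

Lemma last_pos_size w : last_pos w <= size w.
Proof. exact: leq_subr. Qed.

Lemma last_pos0 w : ~~ has P w -> last_pos w = 0.
Proof. by rewrite /last_pos -has_rev => /hasNfind ->; rewrite size_rev subnn. Qed.

Lemma last_pos_rcons w a : P a -> last_pos (rcons w a) = (size w).+1.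
Proof. by move=> Pa; rewrite -cats1 last_pos_cat /= Pa /last_pos /= Pa addn1. Qed.

Lemma last_pos_split w : has P w -> exists u a v,
  [/\ w = u ++ a :: v, P a, ~~ has P v & last_pos w = (size u).+1].
Proof.
elim/last_ind: w => [//|w b IH]; rewrite has_rcons.
case Pb: (P b) => /=.
  by move=> _; exists w, b, [::]; rewrite cats1 last_pos_rcons.
move=> /IH[u [a [v [-> Pa hv E]]]]; exists u, a, (rcons v b); split => //.
- by rewrite rcons_cat.
- by rewrite has_rcons Pb.
- by rewrite rcons_cat /= -cats1 -cat_cons catA last_pos_cat /= Pb.
Qed.

End LastPosition.

Definition slice (A : Type) (y : nat -> A) i n := mkseq (fun k => y (i + k)%N) n.

Section Slices.
Local Open Scope nat_scope.
Variables (A : Type) (y : nat -> A).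

Lemma slice0 n : slice y 0 n = mkseq y n.
Proof. by []. Qed.

Lemma size_slice i n : size (slice y i n) = n.
Proof. exact: size_mkseq. Qed.

Lemma slice1 i : slice y i 1 = [:: y i].
Proof. by rewrite /slice /mkseq /= addn0. Qed.

Lemma slice_add i m n : slice y i (m + n) = slice y i m ++ slice y (i + m) n.
Proof.
rewrite /slice /mkseq iotaD map_cat add0n; congr cat.
rewrite -[in iota m n](addn0 m) iotaDl -map_comp.
by apply: eq_map => k /=; rewrite addnA.
Qed.

Lemma nth_slice a i n k : k < n -> nth a (slice y i n) k = y (i + k).
Proof. by move=> kn; rewrite nth_mkseq. Qed.

Lemma slice_cons i n : slice y i n.+1 = y i :: slice y i.+1 n.
Proof. by rewrite -add1n slice_add slice1 addn1. Qed.

Lemma slice_rcons i n : slice y i n.+1 = rcons (slice y i n) (y (i + n)).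
Proof. by rewrite -addn1 slice_add slice1 cats1. Qed.

Lemma take_slice i m n : take m (slice y i (m + n)) = slice y i m.
Proof. by rewrite slice_add take_size_cat ?size_slice. Qed.

Lemma drop_slice i m n : drop m (slice y i (m + n)) = slice y (i + m) n.
Proof. by rewrite slice_add drop_size_cat ?size_slice. Qed.

Lemma has_slice (P : pred A) i n :
  reflect (exists k, i <= k < i + n /\ P (y k)) (has P (slice y i n)).
Proof.
apply: (iffP idP) => [|[k [/andP[ik kn] Pk]]].
  rewrite /slice /mkseq has_map => /hasP[k]; rewrite mem_iota => kn Pk.
  by exists (i + k); split => //; lia.
rewrite /slice /mkseq has_map; apply/hasP; exists (k - i).
  by rewrite mem_iota; lia.
by rewrite /= subnKC.
Qed.

Lemma last_pos_mkseq (P : pred A) p n : p <= n -> (0 < p -> P (y p.-1)) ->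
  (forall k, p <= k < n -> ~~ P (y k)) -> last_pos P (mkseq y n) = p.
Proof.
move=> pn hp hn; rewrite -(subnKC pn) -slice0 slice_add last_pos_cat add0n.
case: ifP => [/has_slice[k [kk Pk]]|_].
  by move: (hn k); rewrite Pk; move=> H; have := H _; lia.
case: p hp {pn hn} => [|p] hp; first by [].
by rewrite slice_rcons last_pos_rcons ?size_slice //; apply: hp.
Qed.

End Slices.

Section FixedPoint.
Local Open Scope nat_scope.
Variables (A : finType) (s : A -> seq A) (y : nat -> A).
Hypothesis hne : nonerasing s.
Hypothesis hfix : forall n, morph s (mkseq y n) = mkseq y (size (morph s (mkseq y n))).

(* [blk n i] is the position in [y] where the [n]-th image of the letter [y i]
   starts. *)
Definition blk n i := size (iter n (morph s) (mkseq y i)).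

Lemma iter_morph_prefix n i : iter n (morph s) (mkseq y i) = mkseq y (blk n i).
Proof.
rewrite /blk; elim: n => [|n IH]; first by rewrite /= size_mkseq.
by rewrite iterS [in LHS]IH hfix -IH.
Qed.

Lemma blk0n n : blk n 0 = 0.
Proof. by rewrite /blk iter_morph_nil. Qed.

Lemma blk0 i : blk 0 i = i.
Proof. exact: size_mkseq. Qed.

(** As [y] is fixed, its prefix of length [blk n i] is the [n]-th image of its prefix of length [i];
    hence block boundaries compose. *)
Lemma blkD m n i : blk (m + n) i = blk m (blk n i).
Proof. by rewrite {1}/blk iterD iter_morph_prefix. Qed.

Lemma blk_add n i m : blk n (i + m) = blk n i + size (iter n (morph s) (slice y i m)).
Proof. by rewrite /blk -!slice0 slice_add iter_morph_cat size_cat add0n. Qed.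

Lemma blk_mono n i j : i <= j -> blk n i <= blk n j.
Proof. by move=> /subnKC <-; rewrite blk_add leq_addr. Qed.

Lemma blk_lt n i j : i < j -> blk n i < blk n j.
Proof.
move=> ij; rewrite -(subnKC (ltnW ij)) blk_add.
have := size_iter_morph_ge hne n (slice y i (j - i)); rewrite size_slice; lia.
Qed.

Lemma blk_ltE n i j : (blk n i < blk n j) = (i < j).
Proof. by case: (ltnP i j) => [/(blk_lt n)//|/(blk_mono n)]; lia. Qed.

Lemma blk_ge n i : i <= blk n i.
Proof. by have := size_iter_morph_ge hne n (mkseq y i); rewrite size_mkseq. Qed.

Lemma blk_mono_iter m n i : m <= n -> blk m i <= blk n i.
Proof. exact: size_iter_morph_mono. Qed.

Lemma iter_morph_slice n i m :
  iter n (morph s) (slice y i m) = slice y (blk n i) (blk n (i + m) - blk n i).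
Proof.
have := iter_morph_prefix n (i + m).
rewrite -!slice0 slice_add iter_morph_cat add0n slice0 iter_morph_prefix.
rewrite -{1}(subnKC (blk_mono n (leq_addr m i))) slice_add add0n slice0.
by move=> /eqP; rewrite eqseq_cat // => /andP[_ /eqP].
Qed.

Lemma iter_morph_letter n i :
  iter n (morph s) [:: y i] = slice y (blk n i) (blk n i.+1 - blk n i).
Proof. by rewrite -slice1 iter_morph_slice addn1. Qed.

Lemma ancestor n k : exists i, blk n i <= k < blk n i.+1.
Proof.
have ex : exists i, k < blk n i.+1 by exists k; exact: blk_ge.
case: (ex_minnP ex) => i ki min; exists i; rewrite ki andbT.
case: i ki min => [|i] ki min; first by rewrite blk0n.
by rewrite leqNgt; apply/negP => /min; rewrite ltnn.
Qed.

Lemma ancestor_mono n k k' i i' : k <= k' -> blk n i <= k < blk n i.+1 ->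
  blk n i' <= k' < blk n i'.+1 -> i <= i'.
Proof.
move=> kk /andP[h1 h2] /andP[h3 h4]; rewrite leqNgt; apply/negP => ii.
by have := blk_mono n ii; lia.
Qed.

Variable r0 : nat.
Hypothesis hr0 : forall i, r0 <= i -> i < blk 1 i.
Variable Q : nat.
Hypothesis hQ : forall a, size (s a) <= Q.

Lemma blk1S i : blk 1 i.+1 <= blk 1 i + Q.
Proof. by rewrite -[i.+1]addn1 blk_add leq_add2l slice1 /= morph_seq1. Qed.

(** Past [r0] a position lies strictly to the right of its parent, so that passing to parents is a
    terminating descent. *)
Lemma parent_lt k i : r0 <= k -> blk 1 i <= k -> i < k.
Proof.
move=> rk ik; rewrite ltnNge; apply/negP => ki.
by have := blk_mono 1 ki; have := hr0 rk; lia.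
Qed.

(** Both positions are replaced by their parents until the larger one is at most [r0] or both lie in
    one block, of length at most [Q]; their distance is then at most [r0 + Q]. *)
Lemma common_ancestor k k' : k < k' -> exists n i i',
  [/\ i < i' <= i + (r0 + Q), blk n i <= k < blk n i.+1
    & blk n i' <= k' < blk n i'.+1].
Proof.
elim/ltn_ind: k' k => k' IH k kk.
have base : k' <= k + (r0 + Q) -> exists n i i',
  [/\ i < i' <= i + (r0 + Q), blk n i <= k < blk n i.+1
    & blk n i' <= k' < blk n i'.+1].
  by move=> h; exists 0, k, k'; rewrite !blk0; split; lia.
case: (leqP k' r0) => [h|h]; first by apply: base; lia.
have [i hi] := ancestor 1 k; have [i' hi'] := ancestor 1 k'.
have := ancestor_mono (ltnW kk) hi hi'; rewrite leq_eqVlt => /orP[/eqP E|ii].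
  by apply: base; move: (blk1S i) hi hi'; rewrite -E; lia.
have h' : i' < k' by apply: parent_lt; [exact: ltnW|case/andP: hi'].
have [n [j [j' [h1 h2 h3]]]] := IH _ h' _ ii.
exists n.+1, j, j'; split => //.
  by rewrite -add1n !blkD; move: hi h2 => /andP[a b] /andP[c d];
     rewrite (leq_trans (blk_mono 1 c) a) (leq_trans b (blk_mono 1 d)).
by rewrite -add1n !blkD; move: hi' h3 => /andP[a b] /andP[c d];
   rewrite (leq_trans (blk_mono 1 c) a) (leq_trans b (blk_mono 1 d)).
Qed.

Lemma slice_shift n i i0 m : slice y i0 m = slice y i m ->
  forall k, k < blk n (i + m) - blk n i -> y (blk n i0 + k) = y (blk n i + k).
Proof.
move=> E k hk; have := congr1 (iter n (morph s)) E.
rewrite !iter_morph_slice => E2; have := congr1 size E2.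
rewrite !size_slice => E3.
have := congr1 (fun w => nth (y 0) w k) E2.
by rewrite /= !nth_slice // E3.
Qed.

End FixedPoint.

Section FirstOccurrence.
Local Open Scope nat_scope.

Lemma first_occurrence_bound (T : finType) (f : nat -> T) :
  exists J, forall i, exists2 i0, i0 <= J & f i0 = f i.
Proof.
have ex t : exists m, forall i, f i = t -> exists2 i0, i0 <= m & f i0 = t.
  case: (pselect (exists i, f i = t)) => [[i fi]|no].
    by exists i => j _; exists i.
  by exists 0 => i fi; case: no; exists i.
have [m hm] := choice ex.
exists (\max_t m t) => i; have [i0 h E] := hm _ i erefl.
by exists i0 => //; apply: leq_trans h (leq_bigmax _).
Qed.

Lemma first_slice_bound (A : finType) (y : nat -> A) m :
  exists J, forall i n, n <= m -> exists2 i0, i0 <= J & slice y i0 n = slice y i n.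
Proof.
have [J hJ] := first_occurrence_bound (fun i => [ffun k : 'I_m => y (i + k)]).
exists J => i n nm; have [i0 h /ffunP E] := hJ i; exists i0 => //.
apply: (@eq_from_nth _ (y 0)); rewrite !size_slice // => k kn.
by rewrite !nth_slice //; have := E (Ordinal (leq_trans kn nm)); rewrite !ffunE.
Qed.

End FirstOccurrence.

(** * Records *)

Section Records.
Local Open Scope nat_scope.
Variable X : pred nat.

Definition free s l := forall k, s <= k < s + l -> ~~ X k.

(** With [l] taken maximal, this is the start of a gap longer than all earlier ones. The length
    [l = 0] makes 0 a record, hence the restriction to positive or large records below. *)
Definition record s := exists2 l, free s l & forall t, t < s -> ~ free t l.

Lemma free_sub s l t m : free s l -> s <= t -> t + m <= s + l -> free t m.
Proof. by move=> h st tm k hk; apply: h; lia. Qed.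

Lemma first_free t l : free t l ->
  exists2 s, s <= t & free s l /\ forall u, u < s -> ~ free u l.
Proof.
move=> h; have ex : exists s, `[< free s l >] by exists t; apply/asboolP.
case: (ex_minnP ex) => s /asboolP hs min; exists s.
  by apply: min; apply/asboolP.
split => // u us hu; have : s <= u by apply: min; apply/asboolP.
lia.
Qed.

Hypothesis Xinf : forall n, exists2 k, n <= k & X k.
Hypothesis Xgap : forall l, exists s, free s l.

Lemma record_gap s : record s -> exists l,
  [/\ free s l, X (s + l) & forall t, t < s -> ~ free t l].
Proof.
case=> l0 hl0 min.
have ex : exists l, X (s + l).
  by have [k sk Xk] := Xinf s; exists (k - s); rewrite subnKC.
case: (ex_minnP ex) => l Xl minl; exists l.
have l0l : l0 <= l.
  rewrite leqNgt; apply/negP => ll0; have /negP := hl0 (s + l) ltac:(lia); exact.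
split => // [k hk|t ts ht].
  apply/negP => Xk; have := minl (k - s); rewrite subnKC; last lia.
  by move=> /(_ Xk); lia.
by apply: (min t ts); apply: (free_sub ht); lia.
Qed.

Lemma record_pred s l : free s l -> (forall t, t < s -> ~ free t l) ->
  0 < s -> X s.-1.
Proof.
move=> h min s0; apply/negPn/negP => Xs; apply: (min s.-1); first lia.
move=> k hk; case: (eqVneq k s.-1) => [->//|kn]; apply: h; lia.
Qed.

Lemma record_long l0 : exists S, forall s l, S <= s ->
  (forall t, t < s -> ~ free t l) -> l0 <= l.
Proof.
have [s0 h0] := Xgap l0; exists s0.+1 => s l Ss min.
rewrite leqNgt; apply/negP => ll; apply: (min s0 Ss).
apply: (free_sub h0); lia.
Qed.

(** The first free window of length [l.+1] cannot start before [s], by minimality, nor at [s],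
    because of the occurrence at [s + l]. *)
Lemma next_record s l t : X (s + l) -> (forall t, t < s -> ~ free t l) ->
  free t l.+1 -> exists2 s', record s' & s < s' <= t.
Proof.
move=> Xsl min ht; have [s' s't [hs' mins']] := first_free ht.
exists s'; first by exists l.+1.
rewrite s't andbT ltn_neqAle; apply/andP; split.
  apply/eqP => E; have := hs' (s + l); rewrite Xsl E => H.
  by have := H ltac:(lia).
rewrite leqNgt; apply/negP => s's; apply: (min _ s's).
apply: (free_sub hs'); lia.
Qed.

Lemma record_unbounded n : exists2 s, record s & n <= s.
Proof.
have [k nk Xk] := Xinf n; have [t ht] := Xgap k.+1.
have [s _ [hs min]] := first_free ht; exists s; first by exists k.+1.
rewrite leqNgt; apply/negP => sn.
by have /negP := hs k ltac:(lia); apply.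
Qed.

End Records.

(** * Location and growth of the records in a fixed point *)

Section FixedPointRecords.
Local Open Scope nat_scope.
Variables (A : finType) (s : A -> seq A) (y : nat -> A).
Hypothesis hne : nonerasing s.
Hypothesis hfix : forall n, morph s (mkseq y n) = mkseq y (size (morph s (mkseq y n))).
Variable r0 : nat.
Hypothesis hr0 : forall i, r0 <= i -> i < blk s y 1 i.
Variable P : pred A.
Let X k := P (y k).
Hypothesis Xinf : forall n, exists2 k, n <= k & X k.
Hypothesis Xgap : forall l, exists s, free X s l.

Let Q := \max_a size (s a).
Let hQ a : size (s a) <= Q. Proof. exact: leq_bigmax. Qed.

Let blk := blk s y.

(* The gap opening at a record lies in the [n]-th image of a short factor of [y];
   by minimality that factor is at its first occurrence. *)
Lemma record_last_pos : exists J, forall p, record X p -> 0 < p ->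
  exists n i, i <= J /\ p = last_pos P (iter n (morph s) (mkseq y i.+1)).
Proof.
have [J hJ] := first_slice_bound y (r0 + Q).+1; exists J => p rp p0.
have [l [hl Xl min]] := record_gap Xinf rp.
have Xp := record_pred hl min p0.
have kk : p.-1 < p + l by lia.
have [n [i [i' [/andP[ii ii'] h h']]]] := common_ancestor hne hfix hr0 hQ kk.
exists n, i.
have [i0 i0J E] := hJ i (i' - i).+1 ltac:(lia).
have sh := slice_shift hfix (n := n) E.
have Ei : i + (i' - i).+1 = i'.+1 by lia.
rewrite Ei in sh.
have ip : blk n i.+1 <= blk n i' by apply: blk_mono; lia.
have i'p : blk n i' <= blk n i'.+1 by apply: blk_mono; lia.
rewrite -/blk in h h' sh.
split.
  (* If [i0 < i], the gap reappears further left, shifted by [blk n i - blk n i0], against the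
     minimality of [p]. *)
  case: (leqP i i0) => [|i0i]; first by lia.
  exfalso; have b0 := blk_lt y hne n i0i; rewrite -/blk in b0.
  apply: (min (p - (blk n i - blk n i0))); first lia.
  move=> k hk; have := hl (k + (blk n i - blk n i0)) ltac:(lia).
  have := sh (k - blk n i0) ltac:(lia).
  rewrite /X; have -> : blk n i0 + (k - blk n i0) = k by lia.
  have -> : blk n i + (k - blk n i0) = k + (blk n i - blk n i0) by lia.
  by move=> ->.
rewrite (iter_morph_prefix hfix) -/blk; apply/esym/last_pos_mkseq => //; first lia.
by move=> k hk; apply: hl; lia.
Qed.

(** The letters whose image meets [P]. By [hasK], parents of positions in [K] are in [K] and images
    of letters outside [K] avoid [K], so maximal factors avoiding [K] can be followed in both
    directions. *)
Variable K : pred A.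
Hypothesis hasK : forall a, has K (s a) = K a.
Hypothesis hasP : forall a, has P (s a) = K a.

(* Marks: [pl a] is the letter [a] itself, [lm a] (resp. [rm a]) is the letter
   [a] in [K] bounding on the left (resp. right) a maximal factor without letters
   of [K].  [mu] is the action of [s] on such factors. *)
Let B := (A + (A + A))%type.
Let pl (a : A) : B := inl a.
Let lm (a : A) : B := inr (inl a).
Let rm (a : A) : B := inr (inr a).

(** For [a] in [K], the positions of the last and of the first letter of [K] in [s a]: they bound
    the factor left between the images of two consecutive letters of [K]. *)
Let lpos a := (last_pos K (s a)).-1.
Let rpos a := find K (s a).

Let mu (b : B) : seq B := match b with
  | inl a => map pl (s a)
  | inr (inl a) => lm (nth a (s a) (lpos a)) :: map pl (drop (lpos a).+1 (s a))
  | inr (inr a) => rcons (map pl (take (rpos a) (s a))) (rm (nth a (s a) (rpos a)))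
  end.

Let mu_ne : nonerasing mu.
Proof.
case=> [a|[a|a]] //=; last by move/(congr1 size); rewrite size_rcons.
by case E : (s a) => //; have := hne E.
Qed.

Let morph_pl w : morph mu (map pl w) = map pl (morph s w).
Proof. by elim: w => //= a w IH; rewrite !morph_cons map_cat IH. Qed.

Let Kgap i i' := [/\ i < i', K (y i), K (y i') &
  forall k, i < k < i' -> ~~ K (y k)].

Let mk i i' := rcons (lm (y i) :: map pl (slice y i.+1 (i' - i.+1))) (rm (y i')).

Let size_mk i i' : i < i' -> size (mk i i') = (i' - i).+1.
Proof. by move=> h; rewrite size_rcons /= size_map size_slice; lia. Qed.

Let has_morph w : has K (morph s w) = has K w.
Proof. by elim: w => //= a w IH; rewrite morph_cons has_cat hasK IH. Qed.

Let image_letter i : s (y i) = slice y (blk 1 i) (blk 1 i.+1 - blk 1 i).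
Proof. by have := iter_morph_letter hfix 1 i; rewrite /= morph_seq1. Qed.

Let image_slice i m : morph s (slice y i m) = slice y (blk 1 i) (blk 1 (i + m) - blk 1 i).
Proof. exact: (iter_morph_slice hfix 1). Qed.

Let lposP i : K (y i) -> exists m, [/\ blk 1 i.+1 = blk 1 i + lpos (y i) + m.+1,
  K (y (blk 1 i + lpos (y i))),
  (forall k, blk 1 i + lpos (y i) < k < blk 1 i.+1 -> ~~ K (y k)),
  nth (y i) (s (y i)) (lpos (y i)) = y (blk 1 i + lpos (y i)) &
  drop (lpos (y i)).+1 (s (y i)) = slice y (blk 1 i + lpos (y i)).+1 m].
Proof.
rewrite -hasK => /last_pos_split[u [a [v [E Ka Kv hp]]]].
have lE : lpos (y i) = size u by rewrite /lpos hp.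
have b : blk 1 i < blk 1 i.+1 := blk_lt y hne 1 (ltnSn i).
have sz : size (s (y i)) = blk 1 i.+1 - blk 1 i by rewrite image_letter size_slice.
have sz' : size (s (y i)) = size u + (size v).+1 by rewrite E size_cat.
have aE : a = y (blk 1 i + size u).
  have := congr1 (fun w => nth a w (size u)) E.
  rewrite nth_cat ltnn subnn /= image_letter nth_slice //; lia.
have vE : drop (lpos (y i)).+1 (s (y i)) = v.
  by rewrite lE E -cat_rcons drop_size_cat // size_rcons.
have vE' : v = slice y (blk 1 i + size u).+1 (size v).
  rewrite -vE lE image_letter.
  have -> : blk 1 i.+1 - blk 1 i = (size u).+1 + size v by lia.
  by rewrite drop_slice addnS size_slice.
exists (size v); rewrite vE lE; split => //; first lia.
- by rewrite -aE.
- move=> k hk; apply/negP => Kk; move/negP: Kv; apply; rewrite vE'.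
  by apply/has_slice; exists k; split => //; lia.
- by rewrite -aE E nth_cat ltnn subnn.
Qed.

Let rposP i : K (y i) -> exists m, [/\ blk 1 i.+1 = blk 1 i + rpos (y i) + m.+1,
  K (y (blk 1 i + rpos (y i))),
  (forall k, blk 1 i <= k < blk 1 i + rpos (y i) -> ~~ K (y k)),
  nth (y i) (s (y i)) (rpos (y i)) = y (blk 1 i + rpos (y i)) &
  take (rpos (y i)) (s (y i)) = slice y (blk 1 i) (rpos (y i))].
Proof.
rewrite -hasK => hK.
have b : blk 1 i < blk 1 i.+1 := blk_lt y hne 1 (ltnSn i).
have sz : size (s (y i)) = blk 1 i.+1 - blk 1 i by rewrite image_letter size_slice.
have rlt : rpos (y i) < size (s (y i)) by rewrite -has_find.
have nE : nth (y i) (s (y i)) (rpos (y i)) = y (blk 1 i + rpos (y i)).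
  by rewrite [in LHS]image_letter nth_slice // -sz.
have tE : take (rpos (y i)) (s (y i)) = slice y (blk 1 i) (rpos (y i)).
  rewrite [in X in take _ X]image_letter -(subnKC (ltnW rlt)) in sz *.
  by rewrite -sz take_slice.
exists (size (s (y i)) - (rpos (y i)).+1); split => //; first lia.
  by rewrite -nE nth_find.
move=> k hk; apply/negP => Kk.
have : has K (take (rpos (y i)) (s (y i))).
  by rewrite tE; apply/has_slice; exists k.
by rewrite has_take_leq ?ltnn // ltnW.
Qed.

(** Letters inside the gap have images avoiding [K], so the next gap runs from the last letter of
    [K] in the left image to the first one in the right image, which is how [mu] acts on the
    marks. *)
Let Kgap_step i i' : Kgap i i' ->
  let a := blk 1 i + lpos (y i) in let a' := blk 1 i' + rpos (y i') in
  Kgap a a' /\ mk a a' = morph mu (mk i i').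
Proof.
case=> ii Ki Ki' hK a a'.
have [m [e1 e2 e3 e4 e5]] := lposP Ki; have [m' [f1 f2 f3 f4 f5]] := rposP Ki'.
rewrite -/a in e1 e2 e3 e4 e5; rewrite -/a' in f1 f2 f3 f4 f5.
have bm : blk 1 i.+1 <= blk 1 i' by apply: blk_mono.
split.
  split => // [|k hk]; first lia.
  case: (ltnP k (blk 1 i.+1)) => h1; first by apply: e3; lia.
  case: (leqP (blk 1 i') k) => h2; first by apply: f3; lia.
  have : ~~ has K (morph s (slice y i.+1 (i' - i.+1))).
    rewrite has_morph; apply/negP => /has_slice[j [hj]]; apply/negP.
    by apply: hK; lia.
  rewrite image_slice; apply: contra => Kk; apply/has_slice; exists k; split => //.
  by rewrite (_ : i.+1 + (i' - i.+1) = i'); lia.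
rewrite /mk -!cats1 !morph_cat morph_cons morph_pl morph_seq1 image_slice.
rewrite /= e4 e5 f4 f5 subnKC // -cats1.
have -> : a' - a.+1 = m + ((blk 1 i' - blk 1 i.+1) + rpos (y i')) by lia.
rewrite !slice_add !map_cat /= !catA; have -> : a.+1 + m = blk 1 i.+1 by lia.
by rewrite subnKC.
Qed.

(** Same descent as for common ancestors: the parents of two consecutive positions of [K] are in
    [K], with no position of [K] in between. Only finitely many short marked words remain as
    starting points. *)
Let Kgap_ancestor a a' : Kgap a a' -> exists n i i',
  [/\ Kgap i i', i' <= i + (r0 + Q) & mk a a' = iter n (morph mu) (mk i i')].
Proof.
elim/ltn_ind: a' a => a' IH a ga; have [aa Ka Ka' hK] := ga.
have base : a' <= a + (r0 + Q) -> exists n i i',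
  [/\ Kgap i i', i' <= i + (r0 + Q) & mk a a' = iter n (morph mu) (mk i i')].
  by move=> h; exists 0, a, a'; split => //.
case: (leqP a' r0) => [h|h]; first by apply: base; lia.
have [i hi] := ancestor y hne 1 a; have [i' hi'] := ancestor y hne 1 a'.
have := ancestor_mono (ltnW aa) hi hi'; rewrite leq_eqVlt => /orP[/eqP E|ii].
  by apply: base; move: (blk1S y hQ i) hi hi'; rewrite -E; lia.
have Kpar k j : blk 1 j <= k < blk 1 j.+1 -> K (y k) -> K (y j).
  move=> hj Kk; rewrite -hasK image_letter; apply/has_slice; exists k.
  by split => //; lia.
have Ki := Kpar _ _ hi Ka; have Ki' := Kpar _ _ hi' Ka'.
have [m [e1 e2 e3 _ _]] := lposP Ki; have [m' [f1 f2 f3 _ _]] := rposP Ki'.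
rewrite -/blk in hi hi'.
have bm : blk 1 i.+1 <= blk 1 i' by apply: blk_mono.
have Ea : a = blk 1 i + lpos (y i).
  apply/eqP; rewrite eqn_leq; apply/andP; split; rewrite leqNgt; apply/negP => h1.
    by have /negP := e3 a ltac:(lia); apply.
  by have /negP := hK (blk 1 i + lpos (y i)) ltac:(lia); apply.
have Ea' : a' = blk 1 i' + rpos (y i').
  apply/eqP; rewrite eqn_leq; apply/andP; split; rewrite leqNgt; apply/negP => h1.
    by have /negP := hK (blk 1 i' + rpos (y i')) ltac:(lia); apply.
  by have /negP := f3 a' ltac:(lia); apply.
have gi : Kgap i i'.
  split => // k hk; apply/negP => Kk; have [n [g1 g2 _ _ _]] := lposP Kk.
  have b1 : blk 1 i.+1 <= blk 1 k by apply: blk_mono; lia.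
  have b2 : blk 1 k.+1 <= blk 1 i' by apply: blk_mono; lia.
  by have /negP := hK (blk 1 k + lpos (y k)) ltac:(lia); apply.
have i'a' : i' < a' by apply: (parent_lt hr0); [exact: ltnW|case/andP: hi'].
have [n [j [j' [h1 h2 h3]]]] := IH _ i'a' _ gi.
exists n.+1, j, j'; split => //; rewrite iterS -h3.
by have [_] := Kgap_step gi; rewrite Ea Ea'.
Qed.

(** Each of the finitely many starting words either never keeps its length for [#|{: B}|] steps or
    has images of bounded length, by [stalled_word]. The number [b] bounds all lengths at which a
    stall can happen. *)
Let Kgap_grow : exists b, forall a a', Kgap a a' -> b < a' - a ->
  size (mk a a') < size (iter #|{: B}| (morph mu) (mk a a')).
Proof.
pose k := #|{: B}|.
have ex (w : (r0 + Q).+1.-bseq B) : exists b, forall n,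
    size (iter (n + k) (morph mu) w) = size (iter n (morph mu) w) ->
    size (iter n (morph mu) w) <= b.
  case: (pselect (exists n, size (iter (n + k) (morph mu) w) = size (iter n (morph mu) w))).
    move=> [n hn]; exists (size (iter n (morph mu) w)) => m hm.
    case: (leqP n m) => h; first by rewrite (stalled_word mu_ne h hn).
    exact: size_iter_morph_mono (ltnW h).
  by move=> no; exists 0 => n hn; case: no; exists n.
have [b hb] := choice ex.
exists (\max_w b w) => a a' ga hl.
have [n [i [i' [[ii' _ _ _] h E]]]] := Kgap_ancestor ga.
have szw : size (mk i i') <= (r0 + Q).+1 by rewrite size_mk //; lia.
rewrite ltn_neqAle (size_iter_morph_ge mu_ne) andbT; apply/eqP => E2.
have := hb (Bseq szw) n; rewrite addnC iterD -E -E2 => /(_ erefl) h2.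
have := leq_bigmax (F := b) (Bseq szw); rewrite size_mk in h2; last by case: ga.
lia.
Qed.

Let Kgap_iter n a a' : Kgap a a' -> exists b b',
  [/\ Kgap b b', mk b b' = iter n (morph mu) (mk a a') & b < blk n a.+1].
Proof.
move=> ga; elim: n => [|n [b [b' [gb E h]]]].
  by exists a, a'; split => //; rewrite /blk blk0.
have [gb2 E2] := Kgap_step gb; exists (blk 1 b + lpos (y b)), (blk 1 b' + rpos (y b')).
split => //; first by rewrite E2 E.
have [_ Kb _ _] := gb; have [m [e1 _ _ _ _]] := lposP Kb.
have : blk 1 b.+1 <= blk 1 (blk n a.+1) by apply: blk_mono.
by rewrite /blk -(blkD hfix) -/blk add1n; lia.
Qed.

(** One unit is gained every [#|{: B}|] steps, so the number [n] of steps depends on [m] only; the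
    new gap starts before the end of the [n]-th image of [y a]. *)
Let Kgap_long : exists b, forall m, exists n, forall a a', Kgap a a' -> b < a' - a ->
  exists c c', [/\ Kgap c c', a' - a + m <= c' - c & c < blk n a.+1].
Proof.
have [b hb] := Kgap_grow; exists b; elim=> [|m [n IH]].
  exists 0 => a a' ga h; exists a, a'; split => //; first lia.
  by rewrite /blk blk0.
exists (#|{: B}| + n) => a a' ga h.
have [c [c' [gc h1 h2]]] := IH _ _ ga h.
have hc : b < c' - c by lia.
have := hb _ _ gc hc.
have [d [d' [gd E h3]]] := Kgap_iter #|{: B}| gc.
have [dd _ _ _] := gd; have [cc _ _ _] := gc.
rewrite -E !size_mk // => h4; exists d, d'; split => //; first lia.
by rewrite /blk (blkD hfix) -/blk; apply: leq_trans h3 _; apply: blk_mono.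
Qed.

(** The occurrences around the gap have parents [i], [i'] that are consecutive in [K]. The gap of
    [K] in the image is at most [2 * Q] shorter than [l]; once it has gained [2 * Q + 1], the image
    of its interior contains a free window of length [l.+1], and a new record begins. *)
Lemma record_step : exists n S, forall p, S <= p -> record X p ->
  exists2 p', record X p' & p < p' <= blk n p.+1.
Proof.
have [b hb] := Kgap_long; have [n hn] := hb (2 * Q).+1.
have [S hS] := record_long Xgap (b + 2 * Q).+2.
exists (n + 2), S.+1 => p Sp rp.
have [l [hl Xl min]] := record_gap Xinf rp.
have lb := hS p l ltac:(lia) min.
have Xp := record_pred hl min ltac:(lia).
have [i hi] := ancestor y hne 1 p.-1; have [i' hi'] := ancestor y hne 1 (p + l).
rewrite -/blk in hi hi'.
have bi := blk1S y hQ i; have bi' := blk1S y hQ i'; rewrite -/blk in bi bi'.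
have ii : i < i'.
  have pl' : p.-1 <= p + l by lia.
  have := ancestor_mono pl' hi hi'.
  by rewrite leq_eqVlt => /orP[/eqP E|//]; move: hi hi'; rewrite -E; lia.
have Kpar k j : blk 1 j <= k < blk 1 j.+1 -> X k -> K (y j).
  move=> hj Xk; rewrite -hasP image_letter; apply/has_slice; exists k.
  by split => //; lia.
have gi : Kgap i i'.
  split => //; [exact: Kpar hi Xp|exact: Kpar hi' Xl|move=> k hk].
  rewrite -hasP image_letter; apply/negP => /has_slice[j [hj Xj]].
  have b1 : blk 1 i.+1 <= blk 1 k by apply: blk_mono; lia.
  have b2 : blk 1 k.+1 <= blk 1 i' by apply: blk_mono; lia.
  by have /negP := hl j ltac:(lia); apply.
have [gc _] := Kgap_step gi.
set c := blk 1 i + lpos (y i) in gc; set c' := blk 1 i' + rpos (y i') in gc.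
have [_ Ki Ki' _] := gi.
have [m1 [e1 _ _ _ _]] := lposP Ki; have [m2 [f1 _ _ _ _]] := rposP Ki'.
have cc : b < c' - c by rewrite /c /c'; lia.
have [d [d' [[dd Kd Kd' hd] hdl dlt]]] := hn _ _ gc cc.
have fd : free X (blk 1 d.+1) l.+1.
  move=> k hk.
  have := size_iter_morph_ge hne 1 (slice y d.+1 (d' - d.+1)).
  have -> : size (iter 1 (morph s) (slice y d.+1 (d' - d.+1))) = blk 1 d' - blk 1 d.+1.
    by rewrite (iter_morph_slice hfix) size_slice subnKC.
  rewrite size_slice => sz.
  have [j hj] := ancestor y hne 1 k; rewrite -/blk in hj.
  have dj : d < j.
    by rewrite ltnNge; apply/negP => jd; have := blk_mono s y 1 (jd : j < d.+1);
       rewrite -/blk; lia.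
  have jd' : j < d'.
    by rewrite ltnNge; apply/negP => jd; have := blk_mono s y 1 jd; rewrite -/blk /c /c' in hdl *; lia.
  have := hd j ltac:(lia); rewrite -hasP image_letter; apply: contra => Xk.
  by apply/has_slice; exists k; split => //; lia.
have [p' rp' /andP[h1 h2]] := next_record Xl min fd.
exists p' => //; rewrite h1 (leq_trans h2) //.
have -> : n + 2 = 1 + (n + 1) by lia.
rewrite /blk 2!(blkD hfix) -/blk; apply: blk_mono; apply: leq_trans dlt _; apply: blk_mono.
have : blk 1 i.+1 <= blk 1 p.+1 by apply: blk_mono; have := blk_ge y hne 1 i; rewrite -/blk; lia.
rewrite /c; lia.
Qed.

End FixedPointRecords.

(** * Limits of sequences *)

Section Sequences.
Variable R : realType.
Implicit Types (u v : nat -> R) (l : R).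

Lemma cvgn_distP u l : u n @[n --> \oo] --> l <->
  forall e, 0 < e -> exists N, forall n, (N <= n)%N -> `|u n - l| <= e.
Proof.
split => [/cvgrPdist_le h e e0|h].
  by have [N _ hN] := h e e0; exists N => n Nn; rewrite distrC; apply: hN.
apply/cvgrPdist_le => e e0; have [N hN] := h e e0.
by exists N => // n Nn; rewrite distrC; apply: hN.
Qed.

Lemma cvgn_lim_eq u l l' : l = l' -> u n @[n --> \oo] --> l -> u n @[n --> \oo] --> l'.
Proof. by move=> ->. Qed.

Lemma cvgn_eventually_eq u v l N : (forall n, (N <= n)%N -> u n = v n) ->
  v n @[n --> \oo] --> l -> u n @[n --> \oo] --> l.
Proof.
move=> h /cvgn_distP hv; apply/cvgn_distP => e /hv[M hM].
exists (maxn N M) => n; rewrite geq_max => /andP[Nn Mn].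
by rewrite h //; apply: hM.
Qed.

Lemma cvgn_shiftP u l k : u (n + k)%N @[n --> \oo] --> l <-> u n @[n --> \oo] --> l.
Proof.
split => /cvgn_distP h; apply/cvgn_distP => e /h[N hN].
  exists (N + k)%N => n Nn; have -> : n = (n - k + k)%N by lia.
  by apply: hN; lia.
by exists N => n Nn; apply: hN; lia.
Qed.

Lemma cvgn_succ u (l : R) : u n @[n --> \oo] --> l -> u n.+1 @[n --> \oo] --> l.
Proof. by move=> /(cvgn_shiftP u l 1); under eq_fun do rewrite addn1. Qed.

Lemma cvgn_bounded_mul0 u v C N : (forall n, (N <= n)%N -> `|u n| <= C) ->
  v n @[n --> \oo] --> (0 : R) -> u n * v n @[n --> \oo] --> (0 : R).
Proof.
move=> hu /cvgn_distP hv; apply/cvgn_distP => e e0.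
have C1 : 0 < `|C| + 1 by rewrite ltr_pwDr.
have [M hM] := hv (e / (`|C| + 1)) (divr_gt0 e0 C1).
exists (maxn N M) => n; rewrite geq_max => /andP[Nn Mn].
rewrite subr0 normrM; have := hM n Mn; rewrite subr0 => h2.
have h1 : `|u n| <= `|C| + 1.
  by apply: le_trans (hu n Nn) _; apply: le_trans (ler_norm _) _; rewrite lerDl.
apply: le_trans (ler_pM _ _ h1 h2) _ => //.
by rewrite mulrC divfK // gt_eqF.
Qed.

Lemma cvgn_sum (I : Type) (r : seq I) (P : pred I) (F : I -> nat -> R) (L : I -> R) :
  (forall i, P i -> F i n @[n --> \oo] --> L i) ->
  \sum_(i <- r | P i) F i n @[n --> \oo] --> \sum_(i <- r | P i) L i.
Proof.
move=> h; apply: cvg_big => //.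
exact: add_continuous.
Qed.

Lemma cvgn_squeeze0 u v N : (forall n, (N <= n)%N -> `|u n| <= v n) ->
  v n @[n --> \oo] --> (0 : R) -> u n @[n --> \oo] --> (0 : R).
Proof.
move=> h /cvgn_distP hv; apply/cvgn_distP => e /hv[M hM].
exists (maxn N M) => n; rewrite geq_max => /andP[Nn Mn].
rewrite subr0; apply: le_trans (h n Nn) _; have := hM n Mn; rewrite subr0.
exact/le_trans/ler_norm.
Qed.

Lemma cvgn_le u l C N : (forall n, (N <= n)%N -> u n <= C) ->
  u n @[n --> \oo] --> l -> l <= C.
Proof.
move=> h hu; apply: (@cvgr_to_le _ _ _ R u l C hu).
by exists N.
Qed.

Lemma cvgn_ge u l C N : (forall n, (N <= n)%N -> C <= u n) ->
  u n @[n --> \oo] --> l -> C <= l.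
Proof.
move=> h hu; apply: (@cvgr_to_ge _ _ _ R u l C hu).
by exists N.
Qed.

Lemma cvgn_inv u : (forall C, exists N, forall n, (N <= n)%N -> C <= u n) ->
  (u n)^-1 @[n --> \oo] --> (0 : R).
Proof.
move=> h; apply/cvgn_distP => e e0; have [N hN] := h e^-1; exists N => n /hN hn.
have u0 : 0 < u n by apply: lt_le_trans hn; rewrite invr_gt0.
by rewrite subr0 ger0_norm ?invr_ge0 ?(ltW u0) // invf_ple ?posrE.
Qed.

Lemma exists_nat_ge (C : R) : exists N, forall n, (N <= n)%N -> C <= n%:R.
Proof. by have [N _ hN] := nbhs_infty_ger C; exists N. Qed.

(** The oscillation at infinity, limsup minus liminf, is at most [D]. Contracting it proves
    convergence without a candidate for the limit. *)
Definition osc_le u (D : R) := forall e, 0 < e -> exists N, forall m n,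
  (N <= m)%N -> (N <= n)%N -> `|u m - u n| <= D + e.

Lemma osc_le_weak u D D' : D <= D' -> osc_le u D -> osc_le u D'.
Proof.
move=> DD h e /h[N hN]; exists N => m n Nm Nn.
by apply: le_trans (hN _ _ Nm Nn) _; rewrite lerD2r.
Qed.

Lemma osc_le_closed u D : (forall e, 0 < e -> osc_le u (D + e)) -> osc_le u D.
Proof.
move=> h e e0; have e2 : 0 < e / 2 by rewrite divr_gt0.
have [N hN] := h _ e2 _ e2; exists N => m n Nm Nn.
by apply: le_trans (hN _ _ Nm Nn) _; lra.
Qed.

Lemma osc_le_geometric u C q : 0 <= q < 1 -> (forall k, osc_le u (q ^+ k * C)) ->
  osc_le u 0.
Proof.
move=> /andP[q0 q1] h; apply: osc_le_closed => e e0.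
have /cvgn_distP : q ^+ k * C @[k --> \oo] --> (0 * C : R).
  by apply: cvgMr_tmp; apply: cvg_expr; rewrite ger0_norm.
move=> /(_ e e0)[N /(_ N (leqnn N))]; rewrite mul0r subr0 => hN.
by apply: osc_le_weak (h N); rewrite add0r; apply: le_trans (ler_norm _) hN.
Qed.

Lemma osc_le0_cvg u : osc_le u 0 -> exists l, u n @[n --> \oo] --> l.
Proof.
move=> h; suff : cvg (u n @[n --> \oo]) by move=> c; exists (lim (u n @[n --> \oo])).
apply/cauchy_cvgP/cauchy_exP => e e0; have e2 : 0 < e / 2 by rewrite divr_gt0.
have [N hN] := h _ e2; exists (u N); exists N => // n /= Nn.
by rewrite /ball /=; have := hN N n (leqnn N) Nn; rewrite add0r; lra.
Qed.

Lemma cvg_osc_le0 u l : u n @[n --> \oo] --> l -> osc_le u 0.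
Proof.
move=> /cvgn_distP h e e0; have e2 : 0 < e / 2 by rewrite divr_gt0.
have [N hN] := h _ e2; exists N => m n /hN hm /hN hn.
have -> : u m - u n = (u m - l) - (u n - l) by lra.
by apply: le_trans (ler_normB _ _) _; lra.
Qed.

Lemma osc_le_add u v D D' : osc_le u D -> osc_le v D' ->
  osc_le (fun n => u n + v n) (D + D').
Proof.
move=> hu hv e e0; have e2 : 0 < e / 2 by rewrite divr_gt0.
have [N hN] := hu _ e2; have [M hM] := hv _ e2; exists (maxn N M) => m n.
rewrite !geq_max => /andP[Nm Mm] /andP[Nn Mn].
have -> : u m + v m - (u n + v n) = (u m - u n) + (v m - v n) by ring.
apply: le_trans (ler_normD _ _) _.
have := hN _ _ Nm Nn; have := hM _ _ Mm Mn; lra.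
Qed.

Lemma osc_le_scale u c D : 0 < c -> osc_le u D -> osc_le (fun n => c * u n) (c * D).
Proof.
move=> c0 hu e e0; have [N hN] := hu _ (divr_gt0 e0 c0); exists N => m n Nm Nn.
rewrite -mulrBr normrM (ger0_norm (ltW c0)).
have -> : c * D + e = c * (D + e / c) by rewrite mulrDr mulrCA divff ?mulr1 // gt_eqF.
by rewrite ler_wpM2l ?(ltW c0) //; apply: hN.
Qed.

Lemma osc_le_succ u v D N : (forall n, (N <= n)%N -> u n.+1 = v n) ->
  osc_le v D -> osc_le u D.
Proof.
move=> h hv e e0; have [M hM] := hv e e0; exists (maxn N M).+1 => m n.
case: m n => [|m] [|n] //; rewrite !ltnS !geq_max => /andP[Nm Mm] /andP[Nn Mn].
by rewrite !h //; apply: hM.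
Qed.

End Sequences.

Section FiniteTypes.
Variable (T : finType).

Lemma finite_eventually (P : T -> nat -> Prop) :
  (forall a, exists N, forall n, (N <= n)%N -> P a n) ->
  exists N, forall a n, (N <= n)%N -> P a n.
Proof.
move=> h; have [N hN] := choice h; exists (\max_a N a)%N => a n an.
by apply: hN; apply: leq_trans an; apply: leq_bigmax.
Qed.

Lemma finite_lower_bound (R : realType) (f : T -> R) : (forall a, 0 < f a) ->
  exists2 e, 0 < e <= 1 & forall a, e <= f a.
Proof.
move=> f0; exists (\big[Order.min/1]_a f a).
  rewrite bigmin_le_id andbT; elim/big_ind: _ => // x y x0 y0.
  by rewrite lt_min x0 y0.
by move=> a; apply: bigmin_le.
Qed.

Lemma finite_upper_bound (R : realType) (f : T -> R) : exists2 C, 0 < C & forall a, f a <= C.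
Proof.
exists (1 + \sum_a `|f a|); first by rewrite ltr_pwDl // sumr_ge0.
move=> a; rewrite (bigD1 a) //=; apply: le_trans (ler_norm _) _.
by rewrite addrCA lerDl addr_ge0 // sumr_ge0.
Qed.

End FiniteTypes.

(** * Powers of stochastic matrices *)

Section MarkovChain.
Variables (R : realType) (T : finType) (q : T -> T -> R).
Hypothesis q_ge0 : forall a b, 0 <= q a b.
Hypothesis q_sum : forall a, \sum_b q a b = 1 \/ forall b, q a b = 0.
(** Supports of rows decrease along transitions. A class on which the support is constant thus has
    only positive entries, which excludes periodicity. *)
Hypothesis q_trans : forall a b c, 0 < q a b -> 0 < q b c -> 0 < q a c.

Definition average (v : T -> R) a := \sum_b q a b * v b.

Let q_le1 a : \sum_b q a b <= 1.
Proof. by case: (q_sum a) => [->|h] //; rewrite big1 // => b _. Qed.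

Let S a := [set b | 0 < q a b]%SET.

Let q_out a b : b \notin S a -> q a b = 0.
Proof. by rewrite inE -leNgt => h; apply/eqP; rewrite eq_le h q_ge0. Qed.

Let sub a b : b \in S a -> S b \subset S a.
Proof. by rewrite inE => ab; apply/fintype.subsetP => c; rewrite !inE; apply: q_trans. Qed.

Let average_in v a : average v a = \sum_(b in S a) q a b * v b.
Proof.
rewrite /average (bigID (mem (S a))) /= addrC big1 ?add0r // => b /q_out ->.
by rewrite mul0r.
Qed.

Let sum_in a : \sum_b q a b = \sum_(b in S a) q a b.
Proof. by rewrite (bigID (mem (S a))) /= addrC big1 ?add0r // => b /q_out. Qed.

Let q_min : exists2 e : R, 0 < e <= 1 & forall a b, b \in S a -> e <= q a b.
Proof.
have [|e e01 he] := @finite_lower_bound _ R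
  (fun p : T * T => if 0 < q p.1 p.2 then q p.1 p.2 else 1).
  by move=> p; case: ifP.
by exists e => // a b; rewrite inE => ab; have := he (a, b); rewrite /= ab.
Qed.

Section Orbit.
Variable v : T -> R.
Let V k a := iter k average v a.

Let V_bound : exists2 C, 0 < C & forall k a, `|V k a| <= C.
Proof.
have [C C0 hC] := @finite_upper_bound T R (fun a => `|v a|); exists C => //.
elim=> [|k IH] a; first exact: hC.
rewrite /V iterS /average; apply: le_trans (ler_norm_sum _ _ _) _.
apply: (@le_trans _ _ (\sum_b q a b * C)).
  by apply: ler_sum => b _; rewrite normrM ger0_norm // ler_wpM2l // IH.
by rewrite -mulr_suml ler_piMl // ltW.
Qed.

(** One step of [q] averages the sequences, hence also the bounds on their oscillations. *)
Let osc_step a (D : T -> R) : (forall b, b \in S a -> 0 <= D b) ->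
  (forall b, b \in S a -> osc_le (V ^~ b) (D b)) ->
  osc_le (V ^~ a) (\sum_(b in S a) q a b * D b).
Proof.
move=> D0 h e e0.
have [N hN] : exists N, forall b m, (N <= m)%N -> b \in S a ->
    forall n, (N <= n)%N -> (m <= n)%N -> `|V m b - V n b| <= D b + e.
  have [N hN] : exists N : T -> nat, forall b, b \in S a -> forall m n,
      (N b <= m)%N -> (N b <= n)%N -> `|V m b - V n b| <= D b + e.
    have /choice : forall b, exists N, b \in S a -> forall m n,
        (N <= m)%N -> (N <= n)%N -> `|V m b - V n b| <= D b + e.
      move=> b; case: (boolP (b \in S a)) => [bS|_]; last by exists 0%N.
      by have [N hN] := h b bS e e0; exists N.
    by case=> N hN; exists N.
  exists (\max_b N b)%N => b m Nm bS n Nn _.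
  by apply: hN => //; apply: leq_trans (leq_bigmax b) _.
exists N.+1 => m n Nm Nn.
wlog mn : m n Nm Nn / (m <= n)%N.
  by move=> H; case: (leqP m n) => [|/ltnW] mn; [|rewrite distrC]; apply: H.
case: m n Nm Nn mn => [//|m] [//|n] Nm Nn mn.
rewrite /V !iterS !average_in -sumrB.
apply: le_trans (ler_norm_sum _ _ _) _.
apply: (@le_trans _ _ (\sum_(b in S a) q a b * (D b + e))).
  apply: ler_sum => b bS; rewrite -mulrBr normrM ger0_norm // ler_wpM2l //.
  exact: hN.
rewrite (eq_bigr (fun b => q a b * D b + q a b * e)); last by move=> b _; rewrite mulrDr.
rewrite big_split /= lerD2l -mulr_suml ler_piMl ?(ltW e0) // -sum_in.
exact: q_le1.
Qed.

(** All entries within [S a] are at least [e] (Doeblin's condition), so the interval containing the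
    values of [V] on [S a] shrinks by the factor [1 - e] at each step. *)
Let osc_below a : (forall b, b \in S a -> S b = S a) ->
  forall b, b \in S a -> osc_le (V ^~ b) 0.
Proof.
move=> hS b bS; have [e /andP[e0 e1] he] := q_min; have [C C0 hC] := V_bound.
have sum1 c : c \in S a -> \sum_(d in S a) q c d = 1.
  move=> cS; rewrite -(hS c cS) -sum_in.
  by case: (q_sum c) => // h; have := cS; rewrite -(hS c cS) inE h ltxx.
have shrink k : exists x y : R, (forall c, c \in S a -> x <= V k c <= y) /\
    y - x <= (1 - e) ^+ k * (C + C).
  elim: k => [|k [x [y [hxy yx]]]].
    exists (- C), C; split; last by rewrite expr0 mul1r opprK.
    by move=> c _; rewrite -ler_norml.
  pose z := V k b; have /andP[xz zy] := hxy b bS.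
  (* Every state gives weight at least [e] to the value [z] at [b], which pulls both ends towards
     [z]. *)
  exists (x + e * (z - x)), (y - e * (y - z)); split; last first.
    have -> : y - e * (y - z) - (x + e * (z - x)) = (1 - e) * (y - x) by lra.
    by rewrite exprS -mulrA ler_wpM2l // subr_ge0.
  move=> c cS; have bc : b \in S c by rewrite hS.
  have ec : e <= q c b by apply: he.
  have E (w : R) : V k.+1 c - w = \sum_(d in S a) q c d * (V k d - w).
    rewrite /V iterS average_in (hS c cS) -[in LHS](mul1r w) -(sum1 c cS).
    rewrite mulr_suml -sumrB; apply: eq_bigr => d _; by rewrite mulrBr.
  apply/andP; split.
    have : q c b * (z - x) <= V k.+1 c - x.
      rewrite E (bigD1 b) //= lerDl; apply: sumr_ge0 => d /andP[dS _].
      by rewrite mulr_ge0 // subr_ge0; case/andP: (hxy d dS).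
    have : e * (z - x) <= q c b * (z - x) by rewrite ler_wpM2r // subr_ge0.
    lra.
  have : V k.+1 c - y <= q c b * (z - y).
    rewrite E (bigD1 b) //= gerDl; apply: sumr_le0 => d /andP[dS _].
    by rewrite mulr_ge0_le0 // subr_le0; case/andP: (hxy d dS).
  have : e * (y - z) <= q c b * (y - z) by rewrite ler_wpM2r // subr_ge0.
  lra.
have hull k x y : (forall c, c \in S a -> x <= V k c <= y) ->
    forall n c, (k <= n)%N -> c \in S a -> x <= V n c <= y.
  move=> h n c /subnK <-; elim: (n - k)%N c => [|m IH] c cS; first exact: h.
  rewrite addSn /V iterS average_in (hS c cS).
  rewrite -[x]mul1r -[y]mul1r -(sum1 c cS) !mulr_suml.
  by apply/andP; split; apply: ler_sum => d dS; rewrite ler_wpM2l //;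
     case/andP: (IH d dS).
apply: (@osc_le_geometric _ _ (C + C) (1 - e)) => [|k]; first by lra.
have [x [y [hxy yx]]] := shrink k.
move=> d d0; exists k => m n km kn.
have /andP[h1 h2] := hull _ _ _ hxy _ _ km bS.
have /andP[h3 h4] := hull _ _ _ hxy _ _ kn bS.
rewrite ler_norml; apply/andP; split; lra.
Qed.

(** The class leaks: each [b] with support [S a] gives weight at least [e] to [b0], whose
    oscillation is 0, so the common bound on the oscillations contracts by [1 - e]. *)
Let osc_class a : (forall b, b \in S a -> S b != S a -> osc_le (V ^~ b) 0) ->
  (exists2 b, b \in S a & S b != S a) ->
  forall b, b \in S a -> osc_le (V ^~ b) 0.
Proof.
move=> low [b0 b0S b0n] b bS.
case: (eqVneq (S b) (S a)) => [bT|]; last exact: low.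
have [e /andP[e0 e1] he] := q_min; have [C C0 hC] := V_bound.
apply: (@osc_le_geometric _ _ (C + C) (1 - e)) => [|k]; first by lra.
elim: k b bS bT => [|k IH] b bS bT.
  rewrite mul1r => d d0; exists 0%N => m n _ _.
  apply: le_trans (ler_normB _ _) _; apply: (@le_trans _ _ (C + C)); first exact: lerD.
  by rewrite lerDl ltW.
pose D c := if S c == S a then (1 - e) ^+ k * (C + C) else 0.
have Dk : 0 <= (1 - e) ^+ k * (C + C).
  by apply: mulr_ge0; [apply: exprn_ge0|]; lra.
apply: (@osc_le_weak _ _ (\sum_(c in S b) q b c * D c)).
  have -> : \sum_(c in S b) q b c * D c = \sum_(c in S b | c != b0) q b c * D c.
    rewrite (bigD1 b0) /=; last by rewrite bT.
    by rewrite {1}/D (negbTE b0n) mulr0 add0r.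
  apply: (@le_trans _ _ (\sum_(c in S b | c != b0) q b c * ((1 - e) ^+ k * (C + C)))).
    by apply: ler_sum => c _; rewrite ler_wpM2l // /D; case: ifP.
  rewrite -mulr_suml exprS -mulrA ler_wpM2r //.
  have := q_le1 b; rewrite sum_in (bigD1 b0) /=; last by rewrite bT.
  have : e <= q b b0 by apply: he; rewrite bT.
  lra.
apply: osc_step => c cS; first by rewrite /D; case: ifP.
have caS : c \in S a by rewrite -bT.
by rewrite /D; case: (eqVneq (S c) (S a)) => h; [exact: IH|exact: low].
Qed.

(** Induction on the size of the support: states of smaller support are settled, and the others form
    a closed positive class or leak to a settled state. *)
Let osc_null a : osc_le (V ^~ a) 0.
Proof.
have [n an] := ubnPleq #|S a|; elim/ltn_ind: n a an => n IH a an.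
have low b : b \in S a -> S b != S a -> osc_le (V ^~ b) 0.
  move=> bS bn; apply: (IH #|S b|); last exact: leqnn.
  apply: leq_trans an; apply: proper_card.
  by rewrite finset.properEneq bn sub.
have all0 b : b \in S a -> osc_le (V ^~ b) 0.
  case: (pselect (exists2 b, b \in S a & S b != S a)) => ex bS.
    exact: osc_class bS.
  apply: osc_below bS => c cS; apply/eqP/negPn/negP => cn; apply: ex.
  by exists c.
have := osc_step (D := fun=> 0) (a := a) (fun b _ => lexx 0) all0.
by rewrite big1 // => b _; rewrite mulr0.
Qed.

Lemma average_iter_cvg a : exists l : R, iter k average v a @[k --> \oo] --> l.
Proof. exact: osc_le0_cvg (osc_null a). Qed.

End Orbit.

Lemma average_norm v C : (forall a, `|v a| <= C) -> 0 <= C ->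
  forall k a, `|iter k average v a| <= C.
Proof.
move=> hv C0; elim=> [|k IH] a; first exact: hv.
rewrite iterS /average; apply: le_trans (ler_norm_sum _ _ _) _.
apply: (@le_trans _ _ (\sum_b q a b * C)).
  by apply: ler_sum => b _; rewrite normrM ger0_norm // ler_wpM2l.
by rewrite -mulr_suml ler_piMl.
Qed.

(* [E] is the limit of the powers of [q]. *)
Lemma average_limit : exists E : T -> T -> R, [/\ forall a b, 0 <= E a b,
  forall a c, \sum_b E a b * q b c = E a c &
  forall e, 0 < e -> exists k, forall v C a, (forall b, `|v b| <= C) ->
    `|iter k average v a - \sum_b E a b * v b| <= e * C].
Proof.
pose d b : T -> R := fun c => (c == b)%:R.
have ex (p : T * T) : exists l : R, iter k average (d p.2) p.1 @[k --> \oo] --> l.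
  exact: average_iter_cvg.
have [E hE] := choice ex.
have lin k v a : iter k average v a = \sum_b iter k average (d b) a * v b.
  elim: k v a => [|k IH] v a.
    rewrite /= (bigD1 a) //= /d eqxx mul1r big1 ?addr0 // => b ba.
    by rewrite eq_sym (negbTE ba) mul0r.
  rewrite iterS {1}/average; under eq_bigr => b _ do rewrite IH mulr_sumr.
  rewrite exchange_big /=; apply: eq_bigr => b _.
  by rewrite /average mulr_suml; apply: eq_bigr => c _; rewrite mulrA.
exists (fun a b => E (a, b)); split.
- move=> a b; apply: (cvgn_ge (N := 0) _ (hE (a, b))) => k _ /=.
  elim: k a => [|k IH] a; first exact: ler0n.
  by rewrite iterS /average; apply: sumr_ge0 => c _; apply: mulr_ge0 => //; exact: IH.
- move=> a c.
  have h1 : iter k.+1 average (d c) a @[k --> \oo] --> E (a, c).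
    have /(cvgn_shiftP (fun k => iter k average (d c) a) _ 1) := hE (a, c).
    by under eq_fun do rewrite addn1.
  have h2 : iter k.+1 average (d c) a @[k --> \oo] --> \sum_b E (a, b) * q b c.
    have -> : (fun k => iter k.+1 average (d c) a) =
              (fun k => \sum_b iter k average (d b) a * q b c).
      apply/funext => k; rewrite iterSr lin; apply: eq_bigr => b _; congr (_ * _).
      rewrite /average (bigD1 c) //= /d eqxx mulr1 big1 ?addr0 // => x xc.
      by rewrite (negbTE xc) mulr0.
    by apply: cvgn_sum => b _; apply: cvgMr_tmp; exact: (hE (a, b)).
  exact: (cvg_unique _ h2 h1).
- move=> e e0; pose n : R := #|{: T}|%:R + 1.
  have n0 : 0 < n by rewrite ltr_pwDr.
  have [k hk] : exists k, forall p m, (k <= m)%N ->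
      `|iter m average (d p.2) p.1 - E p| <= e / n.
    apply: finite_eventually => p; have /cvgn_distP := hE p.
    by move=> /(_ (e / n) (divr_gt0 e0 n0)).
  exists k => v C a hv; rewrite lin -sumrB.
  apply: le_trans (ler_norm_sum _ _ _) _.
  apply: (@le_trans _ _ (\sum_(b : T) e / n * C)).
    apply: ler_sum => b _; rewrite -mulrBl normrM; apply: ler_pM => //.
    exact: (hk (a, b)).
  have C0 : 0 <= C by apply: le_trans (hv a).
  rewrite sumr_const -[X in X <= _]mulr_natl.
  have -> : #|T|%:R * (e / n * C) = (e * C) * (#|T|%:R / n) by lra.
  rewrite ler_piMr ?mulr_ge0 ?(ltW e0) // ler_pdivrMr // mul1r /n.
  by rewrite lerDl.
Qed.

End MarkovChain.

(** * Growth of letters *)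

Section Binomials.
Variable R : realType.
Local Notation C n d := ('C(n, d)%:R : R).

Lemma leq_bin_sub n d : (n - d <= 'C(n, d.+1))%N.
Proof.
elim: n => [|n IH]; first by rewrite sub0n.
rewrite binS; case: (leqP d n) => dn; last by rewrite (_ : n.+1 - d = 0)%N //; lia.
by rewrite subSn // -addn1 leq_add // bin_gt0.
Qed.

Lemma leq_bin_exp n d : ('C(n, d) <= n ^ d)%N.
Proof.
elim: d => [|d IH]; first by rewrite bin0.
have := mul_bin_left n d => E; rewrite expnS.
apply: (@leq_trans (d.+1 * 'C(n, d.+1))); first by rewrite leq_pmull.
by rewrite E leq_mul // leq_subr.
Qed.

Lemma bin_pinfty d (x : R) : exists N, forall n, (N <= n)%N -> x <= C n d.+1.
Proof.
have [N hN] := exists_nat_ge x; exists (N + d)%N => n Nn.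
apply: le_trans (hN (n - d)%N _) _; first lia.
by rewrite ler_nat leq_bin_sub.
Qed.

Lemma inv_nat_cvg0 : (n.+1%:R : R)^-1 @[n --> \oo] --> (0 : R).
Proof. exact: cvg_harmonic. Qed.

Lemma bin_ratio_cvg1 d : C n d / C n.+1 d @[n --> \oo] --> (1 : R).
Proof.
apply: (@cvgn_eventually_eq _ _ (fun n => 1 - d%:R * n.+1%:R^-1) _ d).
  move=> n dn; have := mul_bin_down n.+1 d; rewrite -pred_Sn => /(congr1 (fun k => k%:R : R)).
  rewrite !natrM natrB; last lia.
  have n0 : n.+1%:R != 0 :> R by rewrite pnatr_eq0.
  have c0 : C n.+1 d != 0 by rewrite pnatr_eq0 -lt0n bin_gt0; lia.
  move=> E; apply/eqP; rewrite eq_sym -(inj_eq (mulIf c0)) divfK //.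
  apply/eqP/(mulfI n0); rewrite E; field.
  by rewrite nat1r pnatr_eq0.
apply: (cvgn_lim_eq (subr0 _)); apply: cvgB; first exact: cvg_cst.
apply: (cvgn_lim_eq (mulr0 d%:R)); apply: cvgMl_tmp; exact: inv_nat_cvg0.
Qed.

Lemma bin_ratio_cvg0 d : C n d / C n d.+1 @[n --> \oo] --> (0 : R).
Proof.
apply/(cvgn_shiftP (fun n => C n d / C n d.+1) _ d.+1).
apply: (@cvgn_eventually_eq _ _ (fun n => d.+1%:R * n.+1%:R^-1) _ 0).
  move=> n _; have := mul_bin_left (n + d.+1) d => /(congr1 (fun k => k%:R : R)).
  have -> : (n + d.+1 - d = n.+1)%N by lia.
  rewrite !natrM => E.
  have n0 : n.+1%:R != 0 :> R by rewrite pnatr_eq0.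
  have c0 : C (n + d.+1) d.+1 != 0 by rewrite pnatr_eq0 -lt0n bin_gt0; lia.
  apply/eqP; rewrite -(inj_eq (mulIf c0)) divfK //.
  apply/eqP/(mulfI n0); rewrite -E; field.
  by rewrite nat1r pnatr_eq0.
apply: (cvgn_lim_eq (mulr0 d.+1%:R)); apply: cvgMl_tmp; exact: inv_nat_cvg0.
Qed.

Lemma bin_lt_ratio_cvg0 d e : (d < e)%N -> C n d / C n e @[n --> \oo] --> (0 : R).
Proof.
elim: e => // e IH; rewrite ltnS leq_eqVlt => /orP[/eqP->|de].
  exact: bin_ratio_cvg0.
apply: (@cvgn_eventually_eq _ _ (fun n => (C n d / C n e) * (C n e / C n e.+1)) _ e).
  move=> n en; rewrite mulrA divfK // pnatr_eq0 -lt0n bin_gt0 //.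
by apply: (cvgn_lim_eq (mulr0 0)); apply: cvgM; [exact: IH|exact: bin_ratio_cvg0].
Qed.

Lemma bin_exp_ratio d : exists2 l : R, 0 < l & C n d / n%:R ^+ d @[n --> \oo] --> l.
Proof.
elim: d => [|d [l l0 IH]].
  exists 1 => //; apply: (@cvgn_eventually_eq _ _ (fun=> 1) _ 0); last exact: cvg_cst.
  by move=> n _; rewrite bin0 expr0 divr1.
exists (l * (1 / d.+1%:R)); first by rewrite mulr_gt0 // divr_gt0.
apply/(cvgn_shiftP (fun n => C n d.+1 / n%:R ^+ d.+1) _ d.+1).
apply: (@cvgn_eventually_eq _ _ (fun n => (C (n + d.+1) d / (n + d.+1)%:R ^+ d) *
  ((1 - d%:R * (n + d).+1%:R^-1) / d.+1%:R)) _ 0).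
  move=> n _; have := mul_bin_left (n + d.+1) d => /(congr1 (fun k => k%:R : R)).
  have -> : (n + d.+1 - d = n.+1)%N by lia.
  rewrite !natrM => E.
  have d0 : d.+1%:R != 0 :> R by rewrite pnatr_eq0.
  have -> : C (n + d.+1) d.+1 = n.+1%:R * C (n + d.+1) d / d.+1%:R.
    by rewrite -E mulrC mulKf.
  have -> : (n + d).+1%:R = (n + d.+1)%:R :> R by rewrite addnS.
  have nd : (n + d.+1)%:R != 0 :> R by rewrite pnatr_eq0; lia.
  have -> : 1 - d%:R * (n + d.+1)%:R^-1 = n.+1%:R / (n + d.+1)%:R :> R.
    apply: (mulIf nd); rewrite divfK // mulrBl divfK // mul1r natrD -!natr1; ring.
  rewrite exprS; field.
  by rewrite nat1r d0 -natrD nd expf_neq0.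
apply: cvgM; first by apply/(cvgn_shiftP (fun n => C n d / n%:R ^+ d) _ d.+1).
apply: cvgMr_tmp; apply: (cvgn_lim_eq (subr0 _)); apply: cvgB; first exact: cvg_cst.
apply: (cvgn_lim_eq (mulr0 d%:R)); apply: cvgMl_tmp.
exact/(cvgn_shiftP (fun n => (n.+1%:R : R)^-1) _ d)/inv_nat_cvg0.
Qed.

(** With [x^-1 = 1 + h], the term of index [d.+1] in the expansion of the [n]-th power of [1 + h]
    already dominates [C n d]. *)
Lemma bin_exp_cvg0 d (x : R) : 0 <= x < 1 -> C n d * x ^+ n @[n --> \oo] --> (0 : R).
Proof.
move=> /andP[]; rewrite le_eqVlt => /orP[/eqP<- _|x0 x1].
  apply: (@cvgn_eventually_eq _ _ (fun=> 0) _ 1); last exact: cvg_cst.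
  by move=> [|n] // _; rewrite expr0n mulr0.
have [h h0 Eh] : exists2 h, 0 < h & x^-1 = 1 + h.
  by exists (x^-1 - 1); [rewrite subr_gt0 invf_gt1|rewrite addrC subrK].
apply: (@cvgn_squeeze0 _ _ (fun n => C n d / C n d.+1 * (h ^+ d.+1)^-1) d.+1).
  move=> n dn; have b0 : 0 < C n d.+1 by rewrite ltr0n bin_gt0.
  rewrite ger0_norm; last by rewrite mulr_ge0 // exprn_ge0 // ltW.
  rewrite -mulrA ler_wpM2l // -invfM.
  rewrite -[leLHS]invrK -exprVn lef_pV2 ?posrE ?mulr_gt0 ?exprn_gt0 ?invr_gt0 //.
  rewrite Eh exprDn (bigD1 (inord d.+1)) //= inordK; last lia.
  rewrite expr1n mul1r mulr_natl lerDl; apply: sumr_ge0 => i _.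
  by rewrite expr1n mul1r mulrn_wge0 // exprn_ge0 // ltW.
apply: (cvgn_lim_eq (mul0r ((h ^+ d.+1)^-1))); apply: cvgMr_tmp.
exact: bin_ratio_cvg0.
Qed.

Lemma growth_ratio_cvg0 d e (x y : R) : 0 < x -> 0 < y ->
  x < y \/ (x = y /\ (d < e)%N) ->
  (C n d * x ^+ n) / (C n e * y ^+ n) @[n --> \oo] --> (0 : R).
Proof.
move=> x0 y0 [xy|[<- de]]; last first.
  apply: (@cvgn_eventually_eq _ _ (fun n => C n d / C n e) _ 0).
    move=> n _; rewrite -mulf_div divff ?mulr1 //.
    by rewrite expf_neq0 // gt_eqF.
  exact: bin_lt_ratio_cvg0.
apply: (@cvgn_squeeze0 _ _ (fun n => C n d * (x / y) ^+ n) e).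
  move=> n en; have e1 : 1 <= C n e by rewrite ler1n bin_gt0.
  rewrite expr_div_n mulrA.
  have p1 : 0 <= C n d * x ^+ n by rewrite mulr_ge0 // exprn_ge0 // ltW.
  have p2 : 0 < y ^+ n by rewrite exprn_gt0.
  rewrite ger0_norm; last by rewrite divr_ge0 // mulr_ge0 // ltW.
  rewrite ler_wpM2l // lef_pV2 ?posrE ?mulr_gt0 //; last exact: lt_le_trans e1.
  by rewrite ler_peMl // ltW.
apply: bin_exp_cvg0; rewrite divr_ge0 ?ltW //= ltr_pdivrMr // mul1r //.
Qed.

(** By Pascal's rule [C n d] is the increment of [C n d.+1], which is why binomial coefficients
    replace powers of [n]: beyond some rank each increment of [G n - l * C n d.+1] is at most
    [e / 2] times that of [C n d.+1]. *)
Lemma stolz_bin (G z : nat -> R) (l : R) d N :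
  (forall n, (N <= n)%N -> G n.+1 = G n + C n d * z n) ->
  z n @[n --> \oo] --> l -> G n / C n d.+1 @[n --> \oo] --> l.
Proof.
move=> hG /cvgn_distP hz; apply/cvgn_distP => e e0.
have e2 : 0 < e / 2 by rewrite divr_gt0.
have [M hM] := hz _ e2; pose N1 := maxn N M.
have key n : (N1 <= n)%N ->
    `|G n - l * C n d.+1| <= `|G N1 - l * C N1 d.+1| + e / 2 * C n d.+1.
  elim: n => [|n IH].
    by rewrite leqn0 => /eqP->; rewrite lerDl mulr_ge0 // ltW.
  rewrite leq_eqVlt => /orP[/eqP->|]; first by rewrite lerDl mulr_ge0 // ltW.
  rewrite ltnS => nN; have {}IH := IH nN.
  have h1 : `|C n d * (z n - l)| <= e / 2 * C n d.
    rewrite normrM ger0_norm // mulrC ler_wpM2r //; apply: hM; rewrite /N1 in nN; lia.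
  rewrite binS natrD hG; last by rewrite /N1 in nN; lia.
  have -> : G n + C n d * z n - l * (C n d.+1 + C n d) =
    (G n - l * C n d.+1) + C n d * (z n - l) by ring.
  apply: le_trans (ler_normD _ _) _; rewrite [e / 2 * (_ + _)]mulrDr addrA; exact: lerD.
have [K hK] := bin_pinfty d ((`|G N1 - l * C N1 d.+1| + 1) / (e / 2)).
exists (maxn N1 K) => n; rewrite geq_max => /andP[N1n Kn].
have := hK n Kn; rewrite ler_pdivrMr // => h2.
have c0 : 0 < C n d.+1.
  apply: lt_le_trans (hK n Kn); rewrite divr_gt0 // ltr_wpDl //.
have -> : G n / C n d.+1 - l = (G n - l * C n d.+1) / C n d.+1.
  by rewrite mulrBl mulfK // gt_eqF.
rewrite normrM normfV [`|C n d.+1|]ger0_norm // ler_pdivrMr //.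
apply: le_trans (key n N1n) _; move: h2; lra.
Qed.

End Binomials.

(** * Limits along a nonprincipal ultrafilter *)

Section UltraLimits.
Variable R : realType.

Lemma ultra_bounded_cvg (U : set_system nat) (z : nat -> R) C :
  UltraFilter U -> (forall n, `|z n| <= C) -> exists l : R, z n @[n --> U] --> l.
Proof.
move=> UU hz.
have [|p [_ clp]] := @segment_compact R (- C) C (z @ U) _.
  by apply: (@filterE _ U) => n /=; rewrite in_itv /= -ler_norml.
exists p => A Ap; case: (in_ultra_setVsetC (z @^-1` A) UU) => // h.
have [x [nx Ax]] := clp (~` A) A h Ap.
by [].
Qed.

Lemma nonprincipal_ultra : exists2 U : set_system nat, UltraFilter U & \oo `<=` U.
Proof. by have [U [UU sub]] := @ultraFilterLemma nat \oo _; exists U. Qed.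

End UltraLimits.

(** * Convergence of normalized lengths at a given growth type *)

Section LetterGrowth.
Variables (R : realType) (A : finType) (s : A -> seq A).
Local Notation C n d := ('C(n, d)%:R : R).

Let u n a : R := (size (iter n (morph s) [:: a]))%:R.

Let u_ge0 n a : 0 <= u n a. Proof. exact: ler0n. Qed.

Let uS n a : u n.+1 a = \sum_(b <- s a) u n b.
Proof. by rewrite /u size_iter_morphS natr_sum. Qed.

Lemma sum_count_mem (t : seq A) (F : A -> R) :
  \sum_(b <- t) F b = \sum_b (count_mem b t)%:R * F b.
Proof.
elim: t => [|a t IH]; first by rewrite big_nil big1 // => b _; rewrite mul0r.
rewrite big_cons IH [in LHS](bigD1 a) //= [in RHS](bigD1 a) //= eqxx.
rewrite natrD mulrDl mul1r addrA; congr (_ + _).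
by apply: eq_bigr => b; rewrite eq_sym => /negbTE ->.
Qed.

Hypothesis s_trans : forall a b c, b \in s a -> c \in s b -> c \in s a.

Section Step.
(** Here [le] stands for the letters of growth type at most [(delta, theta)] and [B] for those of
    exactly this type. *)
Variables (theta : R) (delta : nat) (le B : pred A).
Hypothesis theta0 : 0 < theta.
Let V n a := u n a / (C n delta * theta ^+ n).
Hypothesis le_closed : forall a b, le a -> b \in s a -> le b.
Hypothesis B_le : forall a, B a -> le a.
Hypothesis V_upper : forall a, le a -> exists c N, forall n, (N <= n)%N -> V n a <= c.
Hypothesis V_lower : forall a, B a -> exists2 c, 0 < c &
  exists N, forall n, (N <= n)%N -> c <= V n a.
Hypothesis V_small : forall a, le a -> ~~ B a -> V n a @[n --> \oo] --> (0 : R).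

Let V_ge0 n a : 0 <= V n a.
Proof. by rewrite divr_ge0 // mulr_ge0 // exprn_ge0 // ltW. Qed.

Let r n : R := C n delta / C n.+1 delta.

Let V_succ n a : (delta <= n)%N -> V n.+1 a = r n * (theta^-1 * \sum_(b <- s a) V n b).
Proof.
move=> dn; rewrite /V uS /r -mulr_suml exprS.
have c1 : C n delta != 0 by rewrite pnatr_eq0 -lt0n bin_gt0.
have c2 : C n.+1 delta != 0 by rewrite pnatr_eq0 -lt0n bin_gt0 leqW.
have t0 : theta != 0 by rewrite gt_eqF.
have tn : theta ^+ n != 0 by rewrite expf_neq0.
by field; rewrite c1 c2 t0 tn.
Qed.

Let V_bound : exists2 c, 0 < c & forall n a, le a -> `|V n a| <= c.
Proof.
have /choice[c hc] : forall a, exists c, forall n, le a -> `|V n a| <= c.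
  move=> a; case: (boolP (le a)) => [la|_]; last by exists 0.
  have [c [N hN]] := V_upper la; exists (`|c| + \sum_(n < N) `|V n a|) => n _.
  case: (leqP N n) => [Nn|nN].
    rewrite ger0_norm //; apply: le_trans (hN n Nn) _.
    by apply: le_trans (ler_norm _) _; rewrite lerDl sumr_ge0.
  rewrite (bigD1 (Ordinal nN)) //= addrCA lerDl addr_ge0 // sumr_ge0 //.
have [c0 c00 hc0] := finite_upper_bound c; exists c0 => // n a la.
exact: le_trans (hc a n la) (hc0 a).
Qed.

(* From Cesaro means of [V] along an ultrafilter. *)
Let eigenvector : exists w : A -> R, [/\ forall a, B a -> 0 < w a,
  forall a, ~~ B a -> w a = 0 &
  forall a, B a -> \sum_(b <- s a) w b = theta * w a].
Proof.
have [U UU ooU] := nonprincipal_ultra; have [c c0 hc] := V_bound.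
have PU : ProperFilter U by apply: ultra_proper.
pose mean (z : nat -> R) n := arithmetic_mean z n.
have meanE z n : mean z n = n.+1%:R^-1 * \sum_(0 <= i < n.+1) z i by [].
have meanU z (l : R) : z n @[n --> \oo] --> l -> mean z n @[n --> U] --> l.
  by move=> /cesaro h; apply: cvg_trans h; apply: cvg_app.
have mean_bound z n : (forall i, `|z i| <= c) -> `|mean z n| <= c.
  move=> hz; rewrite meanE normrM normfV normr_nat mulrC ler_pdivrMr //.
  apply: le_trans (ler_norm_sum _ _ _) _.
  apply: le_trans (ler_sum _ (fun i _ => hz i)) _.
  by rewrite big_const_nat subn0 iter_addr_0 mulr_natr.
pose V' a n := if le a then V n a else 0.
have V'b a n : `|V' a n| <= c.
  by rewrite /V'; case: ifP => [la|_]; [exact: hc|rewrite normr0 ltW].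
have /choice[w hw] : forall a, exists l : R, mean (V' a) n @[n --> U] --> l.
  by move=> a; apply: (ultra_bounded_cvg (C := c)) => n; apply: mean_bound.
have V'0 a n : 0 <= V' a n by rewrite /V'; case: ifP.
have w0 a : ~~ B a -> w a = 0.
  move=> nB; have h : V' a n @[n --> \oo] --> (0 : R).
    rewrite /V'; case: (boolP (le a)) => la; first exact: V_small.
    exact: cvg_cst.
  exact: (cvg_unique _ (hw a) (meanU _ _ h)).
exists w; split => // a Ba; have la := B_le Ba.
  have [e e0 [N hN]] := V_lower Ba; apply: lt_le_trans e0 _.
  pose z n := if (n < N)%N then 0 else e.
  have ze : z n @[n --> \oo] --> e.
    apply: (@cvgn_eventually_eq _ _ (fun=> e) _ N); last exact: cvg_cst.
    by move=> n Nn; rewrite /z ltnNge Nn.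
  apply: (ler_cvg_to (meanU _ _ ze) (hw a)).
  apply: nearW => n; rewrite !meanE ler_wpM2l ?invr_ge0 //.
  apply: ler_sum => i _; rewrite /z /V' la; case: ltnP => [_|/hN//].
  exact: V_ge0.
(* The defect in the eigenvector equation. It tends to 0 because [r n] tends to 1, while the means
   of the shifted and unshifted sequences differ by a telescoping sum divided by [n.+1]. *)
pose z n := V' a n.+1 - theta^-1 * \sum_(b <- s a) V' b n.
have lab b : b \in s a -> le b by apply: le_closed.
have sumV n : \sum_(b <- s a) V' b n = \sum_(b <- s a) V n b.
  by rewrite !big_seq; apply: eq_bigr => b /lab; rewrite /V' => ->.
have z0 : z n @[n --> \oo] --> (0 : R).
  apply: (@cvgn_eventually_eq _ _
    (fun n => (theta^-1 * \sum_(b <- s a) V n b) * (r n - 1)) _ delta).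
    move=> n dn; rewrite /z sumV /V' la V_succ //; ring.
  apply: (@cvgn_bounded_mul0 _ _ _ (theta^-1 * \sum_(b <- s a) c) 0).
    move=> n _; rewrite normrM ger0_norm ?invr_ge0 ?(ltW theta0) // ler_wpM2l ?invr_ge0 ?(ltW theta0) //.
    apply: le_trans (ler_norm_sum _ _ _) _; rewrite big_seq [leRHS]big_seq.
    by apply: ler_sum => b /lab lb; apply: hc.
  apply: (cvgn_lim_eq (subrr 1)); apply: cvgB; last exact: cvg_cst.
  exact: bin_ratio_cvg1.
have shift0 : mean (fun n => V' a n.+1 - V' a n) n @[n --> U] --> (0 : R).
  suff : mean (fun n => V' a n.+1 - V' a n) n @[n --> \oo] --> (0 : R).
    by move=> h; apply: cvg_trans h; apply: cvg_app.
  have -> : mean (fun n => V' a n.+1 - V' a n) =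
      (fun n => (V' a n.+1 - V' a 0%N) * n.+1%:R^-1).
    by apply/funext => n; rewrite meanE telescope_sumr // mulrC.
  apply: (@cvgn_bounded_mul0 _ _ _ (c + c) 0); last exact: inv_nat_cvg0.
  by move=> n _; apply: le_trans (ler_normB _ _) _; apply: lerD.
have := meanU _ _ z0.
have -> : mean z = (fun n => (mean (fun n => V' a n.+1 - V' a n) n + mean (V' a) n)
    - theta^-1 * \sum_(b <- s a) mean (V' b) n).
  apply/funext => n; rewrite !meanE /z.
  under [X in _ - _ * X]eq_bigr => b _ do rewrite meanE.
  rewrite -mulrDr -mulr_sumr mulrCA -mulrBr; congr (_ * _).
  rewrite exchange_big /= mulr_sumr -big_split -sumrB /=.
  by apply: eq_bigr => i _; rewrite subrK.
move=> h0.
have h1 : (mean (fun n => V' a n.+1 - V' a n) n + mean (V' a) n)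
    - theta^-1 * \sum_(b <- s a) mean (V' b) n @[n --> U]
    --> (0 + w a) - theta^-1 * \sum_(b <- s a) w b.
  apply: cvgB; first by apply: cvgD.
  apply: cvgMl_tmp; apply: cvg_big => [|b _]; [exact: add_continuous|exact: hw].
have h2 : 0 + w a - theta^-1 * \sum_(b <- s a) w b = 0 by exact: (cvg_unique _ h1 h0).
move/eqP: h2; rewrite add0r subr_eq0 => /eqP ->; rewrite mulrA divff ?mul1r // gt_eqF //.
Qed.

Section Core.
Variables (w : A -> R).
Hypothesis w_gt0 : forall a, B a -> 0 < w a.
Hypothesis w0 : forall a, ~~ B a -> w a = 0.
Hypothesis w_eig : forall a, B a -> \sum_(b <- s a) w b = theta * w a.

(** The incidence matrix on [B], conjugated by the eigenvector (Doob transform); [w_eig] makes its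
    rows sum to 1. *)
Let q a b := if B a && B b then (count_mem b (s a))%:R * w b / (theta * w a) else 0.

Let q_ge0 a b : 0 <= q a b.
Proof.
rewrite /q; case: ifP => // /andP[/w_gt0 wa /w_gt0 wb].
by rewrite divr_ge0 // mulr_ge0 // ltW.
Qed.

Let q_average a (f : A -> R) : B a ->
  \sum_b q a b * f b = (theta * w a)^-1 * \sum_(b <- s a) w b * f b.
Proof.
move=> Ba; rewrite [in RHS]sum_count_mem mulr_sumr; apply: eq_bigr => b _.
rewrite /q Ba /=; case: (boolP (B b)) => [Bb|/w0->]; last by rewrite !mul0r !mulr0.
by ring.
Qed.

Let q_sum a : \sum_b q a b = 1 \/ forall b, q a b = 0.
Proof.
case: (boolP (B a)) => Ba; last by right => b; rewrite /q (negbTE Ba).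
left; have := q_average (fun=> 1) Ba.
under eq_bigr do rewrite mulr1; under [in X in _ = X -> _]eq_bigr do rewrite mulr1.
move=> ->; rewrite w_eig // mulVf // mulf_neq0 ?gt_eqF //; exact: w_gt0.
Qed.

Let q_trans a b c : 0 < q a b -> 0 < q b c -> 0 < q a c.
Proof.
rewrite /q; case: ifP => [/andP[Ba Bb]|]; last by rewrite ltxx.
have pos x y : B x -> B y ->
    (0 < (count_mem y (s x))%:R * w y / (theta * w x)) = (y \in s x).
  move=> Bx By; rewrite -has_pred1 has_count.
  have i0 : 0 < (theta * w x)^-1 by rewrite invr_gt0 mulr_gt0 // w_gt0.
  by rewrite (pmulr_lgt0 _ i0) (pmulr_lgt0 _ (w_gt0 By)) ltr0n.
rewrite Bb pos //; case: ifP => [Bc|]; last by rewrite ltxx.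
have {}Bc : B c := Bc; rewrite Ba Bc /= !pos //; exact: s_trans.
Qed.

(** Normalized lengths in the coordinates of [q]; [eta] is the source term coming from the letters
    outside [B]. *)
Let f n a := if B a then V n a / w a else 0.
Let eta n a := if B a then (theta * w a)^-1 * \sum_(b <- s a | ~~ B b) V n b else 0.

Let f_bound : exists2 c, 0 < c & forall n a, `|f n a| <= c.
Proof.
have [c c0 hc] := V_bound.
have [d d0 hd] := finite_upper_bound (fun a => c * `|w a|^-1).
exists d => // n a; rewrite /f; case: ifP => [Ba|_]; last by rewrite normr0 ltW.
apply: le_trans (hd a); rewrite normrM normfV ler_wpM2r ?invr_ge0 //.
by apply: hc; apply: B_le.
Qed.

Let f_succ n a : (delta <= n)%N -> f n.+1 a = r n * (average q (f n) a + eta n a).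
Proof.
move=> dn; rewrite /f /eta; case: (boolP (B a)) => Ba; last first.
  by rewrite /average big1 ?addr0 ?mulr0 // => b _; rewrite /q (negbTE Ba) mul0r.
rewrite V_succ // -mulrA; congr (_ * _).
rewrite /average q_average // -mulrDr invfM mulrAC; congr (_ * _).
rewrite [in LHS](bigID B) /=.
have E : \sum_(b <- s a) w b * f n b = \sum_(b <- s a | B b) V n b.
  rewrite (bigID B) /= [X in _ + X]big1 ?addr0 => [|b /w0->]; last by rewrite mul0r.
  by apply: eq_bigr => b Bb; rewrite /f Bb mulrC divfK // gt_eqF // w_gt0.
by rewrite E.
Qed.

Let eta0 a : eta n a @[n --> \oo] --> (0 : R).
Proof.
rewrite /eta; case: (boolP (B a)) => Ba; last exact: cvg_cst.
apply: (cvgn_lim_eq (mulr0 ((theta * w a)^-1))); apply: cvgMl_tmp.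
have -> : (fun n => \sum_(b <- s a | ~~ B b) V n b) =
    (fun n => \sum_(b <- s a | (b \in s a) && ~~ B b) V n b).
  by apply/funext => n; rewrite big_seq_cond.
apply: (cvgn_lim_eq (l := \sum_(b <- s a | (b \in s a) && ~~ B b) 0)).
  by rewrite big1.
by apply: cvgn_sum => b /andP[bs nB]; apply: V_small => //; apply: le_closed bs; apply: B_le.
Qed.

Let eta_ge0 n a : 0 <= eta n a.
Proof.
rewrite /eta; case: ifP => // /w_gt0 wa.
by rewrite mulr_ge0 ?invr_ge0 ?mulr_ge0 ?sumr_ge0 ?ltW.
Qed.

(* [E] is the limit of the powers of [q], so [g = E f] is not moved by [q]. *)
Lemma growth_cvg_of_projection (cv : forall E : A -> A -> R, (forall a b, 0 <= E a b) ->
    (forall a c, \sum_b E a b * q b c = E a c) -> forall a,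
    exists l : R, \sum_b E a b * f n b @[n --> \oo] --> l) a :
  B a -> exists l : R, V n a @[n --> \oo] --> l.
Proof.
have [E [E0 Eq Elim]] := average_limit q_ge0 q_sum q_trans.
have /choice[g hg] := cv E E0 Eq.
have [c c0 hc] := f_bound.
(* For fixed [k], iterating the recursion [k] times amounts asymptotically to applying [q] to [f n]
   [k] times; taking [k] large then brings the result close to [E f], which converges. *)
have follow k b : f (n + k)%N b - iter k (average q) (f n) b @[n --> \oo] --> (0 : R).
  elim: k b => [|k IH] b.
    apply: (@cvgn_eventually_eq _ _ (fun=> 0) _ 0); last exact: cvg_cst.
    by move=> n _; rewrite addn0 /= subrr.
  apply: (@cvgn_eventually_eq _ _ (fun n => (average q (f (n + k)%N) b + eta (n + k)%N b) *
     (r (n + k)%N - 1) + (eta (n + k)%N b +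
       \sum_d q b d * (f (n + k)%N d - iter k (average q) (f n) d))) _ delta).
    move=> n dn; rewrite addnS f_succ ?(leq_trans dn) ?leq_addr //.
    rewrite iterS.
    have -> : \sum_d q b d * (f (n + k)%N d - iter k (average q) (f n) d) =
        average q (f (n + k)%N) b - average q (iter k (average q) (f n)) b.
      by rewrite /average -sumrB; apply: eq_bigr => d _; rewrite mulrBr.
    ring.
  apply: (cvgn_lim_eq (addr0 0)); apply: cvgD; last first.
    apply: (cvgn_lim_eq (addr0 0)); apply: cvgD.
      exact/(cvgn_shiftP (fun n => eta n b) _ k).
    apply: (cvgn_lim_eq (l := \sum_d q b d * 0)).
      by rewrite big1 // => d _; rewrite mulr0.
    by apply: cvgn_sum => d _; apply: cvgMl_tmp.
  have /cvgn_distP/(_ 1 ltr01)[N hN] := eta0 b.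
  apply: (@cvgn_bounded_mul0 _ _ _ (c + 1) N).
    move=> n Nn; apply: le_trans (ler_normD _ _) _; apply: lerD.
      exact: (average_norm q_ge0 q_sum (hc _) (ltW c0) 1).
    by have := hN (n + k)%N (leq_trans Nn (leq_addr _ _)); rewrite subr0.
  apply/(cvgn_shiftP (fun n => r n - 1) _ k); apply: (cvgn_lim_eq (subrr 1)).
  by apply: cvgB; [exact: bin_ratio_cvg1|exact: cvg_cst].
move=> Ba; exists (w a * g a).
apply: (@cvgn_eventually_eq _ _ (fun n => w a * f n a) _ 0).
  by move=> n _; rewrite /f Ba mulrC divfK // gt_eqF // w_gt0.
apply: cvgMl_tmp; apply/cvgn_distP => e e0.
have e3 : 0 < e / 3 by rewrite divr_gt0.
have [k hk] := Elim _ (divr_gt0 e3 c0).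
have /cvgn_distP/(_ _ e3)[N1 h1] := follow k a.
have /cvgn_distP/(_ _ e3)[N2 h2] := hg a.
exists (maxn N1 N2 + k)%N => n hn; have -> : n = (n - k + k)%N by lia.
have := h1 (n - k)%N ltac:(lia); have := h2 (n - k)%N ltac:(lia).
have := hk (f (n - k)%N) c a (hc _); rewrite divfK ?gt_eqF // subr0.
set X := f _ _; set Y := iter _ _ _ _; set Z := \sum_b _ => H1 H2 H3.
have -> : X - g a = (X - Y) + ((Y - Z) + (Z - g a)) by ring.
apply: le_trans (ler_normD _ _) _; have := ler_normD (Y - Z) (Z - g a); lra.
Qed.

(* [q] drops out because [E q = E]: what remains in the increment only involves the
   letters of smaller growth. *)
Lemma projection_increment (E : A -> A -> R) (Eq : forall a c, \sum_b E a b * q b c = E a c) a n :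
  (delta <= n)%N -> C n.+1 delta * (\sum_b E a b * f n.+1 b) =
    C n delta * (\sum_b E a b * f n b) + \sum_b E a b * (C n delta * eta n b).
Proof.
move=> dn; have c2 : C n.+1 delta != 0 by rewrite pnatr_eq0 -lt0n bin_gt0 leqW.
under eq_bigr => b _ do rewrite f_succ // mulrCA.
rewrite -mulr_sumr mulrA /r [C n.+1 delta * _]mulrC divfK //.
under eq_bigr => b _ do rewrite mulrDr.
rewrite big_split /= mulrDr; congr (_ * _ + _).
  under eq_bigr => b _ do rewrite /average mulr_sumr.
  rewrite exchange_big /=; apply: eq_bigr => c _; rewrite -Eq mulr_suml.
  by apply: eq_bigr => b _; rewrite mulrA.
by rewrite mulr_sumr; apply: eq_bigr => b _; rewrite mulrCA.
Qed.

(** The binomial factors are 1, so the increments of [E f] are nonnegative, while [f] is bounded. *)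
Lemma projection_cvg0 : delta = 0%N -> forall E : A -> A -> R, (forall a b, 0 <= E a b) ->
  (forall a c, \sum_b E a b * q b c = E a c) -> forall a,
  exists l : R, \sum_b E a b * f n b @[n --> \oo] --> l.
Proof.
move=> d0 E E0 Eq a; have [c c0 hc] := f_bound.
have mono : {homo (fun n => \sum_b E a b * f n b) : n m / (n <= m)%N >-> n <= m}.
  apply: homo_leq => [//|x y z|n]; first exact: le_trans.
  have dn : (delta <= n)%N by rewrite d0.
  have := @projection_increment E Eq a n dn; rewrite d0 !bin0 !mul1r => ->.
  by rewrite lerDl; apply: sumr_ge0 => b _; rewrite mul1r mulr_ge0.
exists (lim (\sum_b E a b * f n b @[n --> \oo])).
apply: nondecreasing_is_cvgn => //; exists (\sum_b E a b * c) => _ [n _ <-].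
apply: ler_sum => b _; rewrite ler_wpM2l //.
exact: le_trans (ler_norm _) (hc n b).
Qed.

(** Letters outside [B] already have limits at the scale [C n d * theta ^+ n], so the increments of
    [C n delta] times [E f] are [C n d] times a convergent sequence, and [stolz_bin] applies. *)
Lemma projection_cvgS d : delta = d.+1 -> (forall a, le a -> ~~ B a ->
    exists l : R, u n a / (C n d * theta ^+ n) @[n --> \oo] --> l) ->
  forall E : A -> A -> R, (forall a b, 0 <= E a b) ->
  (forall a c, \sum_b E a b * q b c = E a c) -> forall a,
  exists l : R, \sum_b E a b * f n b @[n --> \oo] --> l.
Proof.
move=> dE low E E0 Eq a.
have /choice[L hL] : forall b, exists l : R, le b -> ~~ B b ->
    u n b / (C n d * theta ^+ n) @[n --> \oo] --> l.
  move=> b; case: (pselect (exists l : R, u n b / (C n d * theta ^+ n) @[n --> \oo] --> l)).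
    by move=> [l hl]; exists l.
  by move=> no; exists 0 => lb nB; case: no; apply: low.
pose kappa n b := if B b then (theta * w b)^-1 *
  \sum_(c <- s b | (c \in s b) && ~~ B c) u n c / (C n d * theta ^+ n) else 0.
pose z n := \sum_b E a b * kappa n b.
have [l hl] : exists l : R, z n @[n --> \oo] --> l.
  exists (\sum_b E a b * (if B b then (theta * w b)^-1 *
    \sum_(c <- s b | (c \in s b) && ~~ B c) L c else 0)).
  apply: cvgn_sum => b _; apply: cvgMl_tmp; rewrite /kappa.
  case: (boolP (B b)) => Bb; last exact: cvg_cst.
  apply: cvgMl_tmp; apply: cvgn_sum => c /andP[cs nB]; apply: hL => //.
  by apply: le_closed cs; apply: B_le.
exists l.
have cv : C n delta * (\sum_b E a b * f n b) / C n d.+1 @[n --> \oo] --> l.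
  apply: (@stolz_bin _ (fun n => C n delta * (\sum_b E a b * f n b)) z l d delta) => // n dn.
  rewrite (projection_increment Eq a dn); congr (_ + _).
  rewrite /z mulr_sumr; apply: eq_bigr => b _; rewrite [in RHS]mulrCA; congr (_ * _).
  rewrite /kappa /eta; case: (boolP (B b)) => Bb; last by rewrite !mulr0.
  rewrite mulrCA [in RHS]mulrCA; congr (_ * _).
  rewrite [in LHS]big_seq_cond !mulr_sumr; apply: eq_bigr => c _.
  have c1 : C n delta != 0 by rewrite pnatr_eq0 -lt0n bin_gt0.
  have c2 : C n d != 0 by rewrite pnatr_eq0 -lt0n bin_gt0; lia.
  have tn : theta ^+ n != 0 by rewrite expf_neq0 // gt_eqF.
  by rewrite /V; field; rewrite c1 c2 tn.
apply: (cvgn_eventually_eq _ cv (N := delta)) => n dn.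
by rewrite -dE mulrC mulKf // pnatr_eq0 -lt0n bin_gt0.
Qed.

End Core.

Lemma letter_growth_step : (delta = 0%N \/ exists2 d, delta = d.+1 &
    forall a, le a -> ~~ B a ->
    exists l : R, u n a / (C n d * theta ^+ n) @[n --> \oo] --> l) ->
  forall a, le a -> exists l : R, V n a @[n --> \oo] --> l.
Proof.
move=> low a la; case: (boolP (B a)) => Ba; last by exists 0; exact: V_small.
have [w [w1 w2 w3]] := eigenvector.
apply: (growth_cvg_of_projection w1 w2 w3) => //.
case: low => [d0|[d dE hd]]; first exact: projection_cvg0.
exact: (projection_cvgS w1 w2 dE hd).
Qed.

End Step.
End LetterGrowth.

(** * From two-sided bounds on lengths to asymptotics *)

Section GrowthTypes.
Variables (R : realType) (A : finType) (s : A -> seq A).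
Local Notation C n d := ('C(n, d)%:R : R).
Let u n a : R := (size (iter n (morph s) [:: a]))%:R.

Hypothesis s_trans : forall a b c, b \in s a -> c \in s b -> c \in s a.
Variables (d : A -> nat) (al : A -> R).
Hypothesis hgrowth : forall a, letter_growth_type s a (d a) (al a).

Lemma al_gt0 a : 0 < al a.
Proof. by case: (hgrowth a) => h _; apply: lt_le_trans h. Qed.

Lemma growth_bounds a : exists c1 c2 N, [/\ 0 < c1, 0 < c2 &
  forall n, (N <= n)%N -> c1 * (C n (d a) * al a ^+ n) <= u n a <= c2 * (C n (d a) * al a ^+ n)].
Proof.
have [_ [c1 [c2 [c10 c20 [N _ hN]]]]] := hgrowth a.
have [l l0 hl] := bin_exp_ratio R (d a).
have l2 : 0 < l / 2 by rewrite divr_gt0.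
have /cvgn_distP/(_ _ l2)[M hM] := hl.
exists c1, (c2 * (l / 2)^-1), (maxn (maxn N M) 1); split => //.
  by rewrite mulr_gt0 // invr_gt0.
move=> n; rewrite !geq_max -andbA => /and3P[Nn Mn n0].
have an : 0 <= al a ^+ n by rewrite exprn_ge0 // ltW // al_gt0.
have /andP[h1 h2] := hN n Nn; apply/andP; split.
  apply: le_trans h1; rewrite ler_wpM2l ?(ltW c10) // ler_wpM2r //.
  by rewrite -natrX ler_nat leq_bin_exp.
apply: le_trans h2 _; rewrite -mulrA ler_wpM2l ?(ltW c20) // mulrA ler_wpM2r //.
have nd : 0 < n%:R ^+ d a :> R by rewrite exprn_gt0 // ltr0n.
have := hM n Mn; rewrite ler_norml => /andP[h3 _].
have h4 : l / 2 <= C n (d a) / n%:R ^+ d a by lra.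
by rewrite mulrC ler_pdivlMr // mulrC -ler_pdivlMr.
Qed.

Lemma lower_type_cvg0 theta delta a : 0 < theta ->
  al a < theta \/ al a = theta /\ (d a < delta)%N ->
  u n a / (C n delta * theta ^+ n) @[n --> \oo] --> (0 : R).
Proof.
move=> t0 h; have [c1 [c2 [N [c10 c20 hN]]]] := growth_bounds a.
apply: (@cvgn_squeeze0 _ _ (fun n => c2 * ((C n (d a) * al a ^+ n) / (C n delta * theta ^+ n))) N).
  move=> n Nn; have p : 0 <= C n delta * theta ^+ n by rewrite mulr_ge0 // exprn_ge0 // ltW.
  rewrite ger0_norm ?divr_ge0 // mulrA ler_wpM2r ?invr_ge0 //.
  by case/andP: (hN n Nn).
apply: (cvgn_lim_eq (mulr0 c2)); apply: cvgMl_tmp.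
by apply: growth_ratio_cvg0 => //; exact: al_gt0.
Qed.

Lemma den_ratio e theta : 0 < theta ->
  (C n e * theta ^+ n) / (C n.+1 e * theta ^+ n.+1) @[n --> \oo] --> theta^-1.
Proof.
move=> t0; apply: (@cvgn_eventually_eq _ _ (fun n => C n e / C n.+1 e * theta^-1) _ e).
  move=> n en; have c2 : C n.+1 e != 0 by rewrite pnatr_eq0 -lt0n bin_gt0 leqW.
  have tn : theta ^+ n != 0 by rewrite expf_neq0 // gt_eqF.
  have t1 : theta != 0 by rewrite gt_eqF.
  by rewrite exprS; field; rewrite t1 tn c2.
apply: (cvgn_lim_eq (mul1r _)); apply: cvgMr_tmp; exact: bin_ratio_cvg1.
Qed.

Lemma image_le a b n : b \in s a -> u n b <= u n.+1 a.
Proof.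
move=> bs; rewrite /u ler_nat size_iter_morphS.
rewrite (big_rem b) //=; exact: leq_addr.
Qed.

(** Otherwise [u n b], which is at most [u n.+1 a], would be negligible at its own scale. *)
Lemma type_image a b : b \in s a -> ~ (al a < al b \/ al a = al b /\ (d a < d b)%N).
Proof.
move=> bs h; have b0 := al_gt0 b.
have h0 := lower_type_cvg0 b0 h.
have [c1 [c2 [N [c10 c20 hN]]]] := growth_bounds b.
have h1 : c1 * ((C n (d b) * al b ^+ n) / (C n.+1 (d b) * al b ^+ n.+1)) -
    u n.+1 a / (C n.+1 (d b) * al b ^+ n.+1) @[n --> \oo] --> c1 * (al b)^-1 - 0.
  apply: cvgB; first by apply: cvgMl_tmp; apply: den_ratio.
  exact: (cvgn_succ h0).
have : c1 * (al b)^-1 - 0 <= 0.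
  apply: (cvgn_le (N := N) _ h1) => n Nn; rewrite mulrA -mulrBl.
  rewrite mulr_le0_ge0 //; last by rewrite invr_ge0 mulr_ge0 // exprn_ge0 // ltW.
  rewrite subr_le0; apply: le_trans (image_le n bs).
  by case/andP: (hN n Nn).
by rewrite subr0; apply/negP; rewrite -ltNge mulr_gt0 // invr_gt0.
Qed.

Let type_le theta delta a := al a < theta \/ al a = theta /\ (d a <= delta)%N.

Let letter_cvg_step delta theta : 0 < theta ->
  (delta = 0%N \/ exists2 e, delta = e.+1 & forall a, type_le theta e a ->
    exists l : R, u n a / (C n e * theta ^+ n) @[n --> \oo] --> l) ->
  forall a, type_le theta delta a ->
  exists l : R, u n a / (C n delta * theta ^+ n) @[n --> \oo] --> l.
Proof.
move=> t0 low.
pose le a := (al a < theta) || ((al a == theta) && (d a <= delta)%N).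
pose B a := (al a == theta) && (d a == delta).
have leP' a : reflect (type_le theta delta a) (le a).
  apply: (iffP orP) => [[h|/andP[/eqP]]|[h|[-> h]]]; [by left|by right|by left|].
  by right; rewrite eqxx.
have lowP a : le a -> ~~ B a -> al a < theta \/ al a = theta /\ (d a < delta)%N.
  case/orP => [h|/andP[/eqP E h]]; first by left.
  by rewrite /B E eqxx /= => h'; right; rewrite ltn_neqAle h' h.
have small a : le a -> ~~ B a -> u n a / (C n delta * theta ^+ n) @[n --> \oo] --> (0 : R).
  by move=> la nB; apply: lower_type_cvg0 => //; apply: lowP.
have BP a : B a -> al a = theta /\ d a = delta by case/andP => /eqP-> /eqP->.
have den0 n : (delta <= n)%N -> 0 < C n delta * theta ^+ n.
  by move=> dn; rewrite mulr_gt0 ?exprn_gt0 // ltr0n bin_gt0.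
have step := @letter_growth_step R A s s_trans theta delta le B t0.
move=> a /leP'; apply: step.
- move=> b c /leP' hb cs; apply/leP'.
  have := type_image cs => no; rewrite /type_le.
  have tb : al b <= theta by case: hb => [/ltW|[->]].
  case: (ltgtP (al c) theta) => [|tc|tc]; [by left| |right; split => //].
    by case: no; left; apply: le_lt_trans tb tc.
  rewrite leqNgt; apply/negP => dd; apply: no; rewrite tc.
  case: hb => [|[-> db]]; first by left.
  by right; split => //; apply: leq_ltn_trans db dd.
- by move=> b /BP[E1 E2]; apply/leP'; right; rewrite E1 E2.
- move=> b lb; case: (boolP (B b)) => [/BP[E1 E2]|nB].
    have [c1 [c2 [N [_ _ hN]]]] := growth_bounds b; exists c2, (maxn N delta) => n.
    rewrite geq_max => /andP[/hN/andP[_ h] dn].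
    by rewrite ler_pdivrMr ?den0 //; rewrite E1 E2 in h.
  have /cvgn_distP/(_ 1 ltr01)[N hN] := small b lb nB; exists 1, N => n /hN.
  by rewrite subr0; apply: le_trans; exact: ler_norm.
- move=> b /BP[E1 E2]; have [c1 [c2 [N [c10 _ hN]]]] := growth_bounds b.
  exists c1 => //; exists (maxn N delta) => n.
  rewrite geq_max => /andP[/hN/andP[h _] dn].
  by rewrite ler_pdivlMr ?den0 //; rewrite E1 E2 in h.
- exact: small.
- case: low => [->|[e E low]]; [by left|right; exists e => // b lb nB].
  apply: low; case: (lowP b lb nB) => [h|[h1 h2]]; [by left|right].
  by split => //; move: h2; rewrite E ltnS.
Qed.

(** Induction on [delta] with [theta] fixed. Letters of smaller type get the limit 0, so that all
    letters share one scale. *)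
Lemma letter_cvg delta theta a : 0 < theta -> type_le theta delta a ->
  exists l : R, u n a / (C n delta * theta ^+ n) @[n --> \oo] --> l.
Proof.
move=> t0; elim: delta a => [|delta IH] a; apply: letter_cvg_step => //.
  by left.
by right; exists delta.
Qed.

Lemma letter_cvg_gt0 a : exists2 l : R, 0 < l &
  u n a / (C n (d a) * al a ^+ n) @[n --> \oo] --> l.
Proof.
have [l hl] := @letter_cvg (d a) (al a) a (al_gt0 a) (or_intror (conj erefl (leqnn _))).
exists l => //; have [c1 [c2 [N [c10 _ hN]]]] := growth_bounds a.
apply: lt_le_trans c10 _; apply: (cvgn_ge (N := maxn N (d a)) _ hl) => n.
rewrite geq_max => /andP[/hN/andP[h _] dn].
by rewrite ler_pdivlMr // mulr_gt0 ?exprn_gt0 ?al_gt0 // ltr0n bin_gt0.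
Qed.

End GrowthTypes.

(** * Positions of records *)

Section PositionGrowth.
Variables (R : realType) (A : finType) (s : A -> seq A).
Local Notation C n d := ('C(n, d)%:R : R).
Variables (D : nat) (Theta : R).
Hypothesis Theta1 : 1 < Theta.
Let den n := C n D * Theta ^+ n.
Hypothesis letters : forall a, exists l : R,
  (size (iter n (morph s) [:: a]))%:R / den n @[n --> \oo] --> l.
Variables (P K : pred A).
Hypothesis hasK : forall a, has K (s a) = K a.
Hypothesis hasP : forall a, has P (s a) = K a.

Let Theta0 : 0 < Theta. Proof. exact: lt_trans Theta1. Qed.

Lemma word_cvg w : exists l : R,
  (size (iter n (morph s) w))%:R / den n @[n --> \oo] --> l.
Proof.
have /choice[l hl] := letters; exists (\sum_(a <- w) l a).
under eq_fun do rewrite size_iter_morph natr_sum mulr_suml.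
exact: cvgn_sum.
Qed.

Lemma has_morphK w : has K (morph s w) = has K w.
Proof. by elim: w => //= a w IH; rewrite morph_cons has_cat hasK IH. Qed.

Lemma has_iter_morph n w : has P (iter n.+1 (morph s) w) = has K w.
Proof.
have hP v : has P (morph s v) = has K v.
  by elim: v => //= a v IH; rewrite morph_cons has_cat hasP IH.
by rewrite iterS hP; elim: n => //= n IH; rewrite has_morphK.
Qed.

Let O n w := last_pos P (iter n (morph s) w).

Let O_cat n u a v : K a -> ~~ has K v ->
  O n.+1 (u ++ a :: v) = (size (iter n.+1 (morph s) u) + O n.+1 [:: a])%N.
Proof.
move=> Ka Kv; rewrite /O -cat1s !iter_morph_cat last_pos_cat has_cat.
by rewrite !has_iter_morph /= Ka last_pos_cat has_iter_morph (negbTE Kv).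
Qed.

Let den_ge0 n : 0 <= den n.
Proof. by rewrite mulr_ge0 // exprn_ge0 // ltW. Qed.

Let o n w : R := (O n w)%:R / den n.

Let o_bound : exists2 c, 0 < c & forall a, exists N, forall n, (N <= n)%N -> `|o n [:: a]| <= c.
Proof.
have /choice[l hl] := letters.
have [c c0 hc] := finite_upper_bound (fun a => l a + 1); exists c => // a.
have /cvgn_distP/(_ 1 ltr01)[N hN] := hl a; exists N => n /hN.
rewrite ler_norml => /andP[_ h]; rewrite ger0_norm ?divr_ge0 //.
apply: (@le_trans _ _ ((size (iter n (morph s) [:: a]))%:R / den n)).
  by rewrite ler_wpM2r ?invr_ge0 // ler_nat last_pos_size.
by apply: le_trans (hc a); lra.
Qed.

(* [K a] reproduces: the last letter of [K] in [s a] drives the recursion, which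
   contracts by a factor [Theta]. *)
Let o_osc a : K a -> osc_le (fun n => o n [:: a]) 0.
Proof.
have /choice[p hp] : forall a, exists p : seq A * A, K a ->
    K p.2 /\ forall n, O n.+2 [:: a] =
      (size (iter n.+1 (morph s) p.1) + O n.+1 [:: p.2])%N.
  move=> b; case: (boolP (K b)) => [|_]; last by exists ([::], b).
  rewrite -hasK => /last_pos_split[u [x [v [E Kx Kv _]]]]; exists (u, x) => _.
  by split => // n; rewrite {1}/O iter_morphS E; exact: O_cat.
have [c c0 hc] := o_bound.
move=> Ka; apply: (@osc_le_geometric _ _ (c + c) Theta^-1) => [|k].
  by rewrite invr_ge0 (ltW Theta0) invf_lt1.
elim: k a Ka => [|k IH] a Ka.
  rewrite expr0 mul1r => e e0; have [N hN] := hc a; exists N => m n Nm Nn.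
  apply: le_trans (ler_normB _ _) _; apply: (@le_trans _ _ (c + c)); last by rewrite lerDl ltW.
  by apply: lerD; apply: hN.
have [Kp Op] := hp a Ka.
have [l hl] := word_cvg (p a).1.
pose S n : R := (size (iter n (morph s) (p a).1))%:R / den n.
pose rho n := den n / den n.+1.
have hrho : rho n @[n --> \oo] --> Theta^-1 by apply: den_ratio.
apply: (@osc_le_succ _ _ (fun n => Theta^-1 * (S n + o n [:: (p a).2]) +
    (S n + o n [:: (p a).2]) * (rho n - Theta^-1)) _ D.+1).
  case=> // n Dn; rewrite /o Op natrD /S /rho.
  have d0 m : (D <= m)%N -> den m != 0.
    by move=> Dm; rewrite mulf_neq0 ?expf_neq0 ?gt_eqF // ltr0n bin_gt0.
  have := d0 n.+1 ltac:(lia); have := d0 n.+2 ltac:(lia) => n1 n2.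
  by field; rewrite n1 n2 gt_eqF.
rewrite exprS -mulrA -[X in osc_le _ X]addr0; apply: osc_le_add.
  apply: osc_le_scale; first by rewrite invr_gt0.
  rewrite -[X in osc_le _ X]add0r; apply: osc_le_add; last exact: IH.
  exact: cvg_osc_le0 hl.
apply: (@cvg_osc_le0 _ _ 0).
have [N hN] := hc (p a).2.
have /cvgn_distP/(_ 1 ltr01)[M hM] := hl.
apply: (@cvgn_bounded_mul0 _ _ _ (`|l| + 1 + c) (maxn N M)).
  move=> n; rewrite geq_max => /andP[Nn Mn]; apply: le_trans (ler_normD _ _) _.
  apply: lerD; last exact: hN.
  have -> : S n = l + (S n - l) by rewrite addrC subrK.
  by apply: le_trans (ler_normD _ _) _; rewrite lerD2l; apply: hM.
by apply: (cvgn_lim_eq (subrr Theta^-1)); apply: cvgB => //; exact: cvg_cst.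
Qed.

(** The word is cut at its last letter of [K]: what precedes contributes the length of its images,
    the letter itself a sequence of zero oscillation, and what follows contains no occurrence from
    the first image on. *)
Lemma last_pos_cvg w : exists l : R,
  (last_pos P (iter n (morph s) w))%:R / den n @[n --> \oo] --> l.
Proof.
case: (boolP (has K w)) => [/last_pos_split[u [a [v [-> Ka Kv _]]]]|Kw]; last first.
  exists 0; apply: (@cvgn_eventually_eq _ _ (fun=> 0) _ 1); last exact: cvg_cst.
  by case=> // n _; rewrite last_pos0 ?mul0r // has_iter_morph.
have [l1 h1] := word_cvg u; have [l2 h2] := osc_le0_cvg (o_osc Ka).
exists (l1 + l2).
apply: (@cvgn_eventually_eq _ _ (fun n => (size (iter n (morph s) u))%:R / den n +
  o n [:: a]) _ 1); last exact: cvgD.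
by case=> // n _; rewrite -/(O n.+1 _) O_cat // natrD mulrDl.
Qed.

End PositionGrowth.

(** * Records of one substitution, measured on the scale of its growth *)

Section RecordAsymptotics.
Variable R : realType.
Local Notation C n d := ('C(n, d)%:R : R).

(* The set of records enters the comparison of two substitutions only through
   the next three properties. *)
Definition steps_bounded (rec : nat -> Prop) (lam : R) := exists S, forall t,
  (S <= t)%N -> rec t -> exists2 t', rec t' & (t < t')%N /\ t'%:R <= lam * t%:R.

Definition steps_vanishing (rec : nat -> Prop) := forall e, 0 < e ->
  steps_bounded rec (1 + e).

Definition exp_poly_positions (rec : nat -> Prop) (D : nat) (Theta : R) :=
  exists (J : nat) (pos : nat -> nat -> nat) (gam : nat -> R) (rel : pred nat) (S : nat),
    (forall j, rel j -> 0 < gam j /\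
       (pos j n)%:R / (C n D * Theta ^+ n) @[n --> \oo] --> gam j) /\
    forall t, (S <= t)%N -> rec t -> exists j n, [/\ (j < J)%N, rel j & t = pos j n].

Variables (A : finType) (s : A -> seq A) (y : nat -> A).
Hypothesis hne : nonerasing s.
Hypothesis hfix : forall n, morph s (mkseq y n) = mkseq y (size (morph s (mkseq y n))).
Variables (P K : pred A).
Hypothesis hasK : forall a, has K (s a) = K a.
Hypothesis hasP : forall a, has P (s a) = K a.
Let X k := P (y k).
Hypothesis Xinf : forall n, exists2 k, (n <= k)%N & X k.
Hypothesis Xgap : forall l, exists t, free X t l.
Variables (D : nat) (Theta : R).
Hypothesis D0 : (0 < D)%N.
Hypothesis Theta1 : 1 <= Theta.
Let den n := C n D * Theta ^+ n.
Hypothesis letters : forall a, exists l : R,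
  (size (iter n (morph s) [:: a]))%:R / den n @[n --> \oo] --> l.
Variable i0 : nat.
Hypothesis top : exists2 l : R, 0 < l &
  (size (iter n (morph s) [:: y i0]))%:R / den n @[n --> \oo] --> l.

Local Notation bl := (blk s y).

Let Theta0 : 0 < Theta. Proof. exact: lt_le_trans Theta1. Qed.

Let den_gt0 n : (D <= n)%N -> 0 < den n.
Proof. by move=> Dn; rewrite mulr_gt0 ?exprn_gt0 // ltr0n bin_gt0. Qed.

Let den_infty (c : R) : exists N, forall n, (N <= n)%N -> c <= den n.
Proof.
have [N hN] := bin_pinfty D.-1 c; exists N => n /hN; rewrite prednK // => h.
apply: le_trans h _; rewrite ler_peMr // exprn_ege1 //.
Qed.

Let top_infty m : exists N, forall n, (N <= n)%N ->
  (m <= size (iter n (morph s) [:: y i0]))%N.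
Proof.
have [l l0 hl] := top; have l2 : 0 < l / 2 by rewrite divr_gt0.
have /cvgn_distP/(_ _ l2)[N1 h1] := hl.
have [N2 h2] := den_infty (m%:R / (l / 2)).
exists (maxn (maxn N1 N2) D) => n; rewrite !geq_max -andbA => /and3P[/h1 g1 /h2 g2 Dn].
rewrite -(ler_nat R); move: g2; rewrite ler_pdivrMr // => g2.
move: g1; rewrite ler_norml => /andP[g1 _].
have {}g1 : l / 2 <= (size (iter n (morph s) [:: y i0]))%:R / den n by lra.
by apply: le_trans g2 _; rewrite mulrC -ler_pdivlMr // den_gt0.
Qed.

(** If all letters of [y] had images of length 1, the images of [y i0] would not grow. Beyond a
    letter with a longer image, every block is shifted to the right. *)
Let expanding_from : exists r0, forall i, (r0 <= i)%N -> (i < bl 1 i)%N.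
Proof.
have [i1 hi1] : exists i, (1 < size (s (y i)))%N.
  apply: contrapT => no; have [N /(_ N (leqnn N))] := top_infty 2.
  apply/negP; rewrite -ltnNge ltnS.
  have small m i : (m <= 1)%N -> (size (iter m (morph s) [:: y i]) <= 1)%N.
    case: m => [|[|m]] //= _; rewrite morph_seq1 leqNgt; apply/negP => h.
    by apply: no; exists i.
  have one k : size (iter k (morph s) [:: y i0]) = 1%N /\
      exists i, iter k (morph s) [:: y i0] = [:: y i].
    elim: k => [|k [_ [i E]]]; first by split=> //; exists i0.
    rewrite iterS E morph_seq1.
    have := small 1%N i (leqnn 1); rewrite /= morph_seq1.
    have := nonerasing_gt0 hne (y i).
    have := iter_morph_letter hfix 1 i; rewrite /= morph_seq1 => E2.
    rewrite [in X in X -> _]E2 E2 !size_slice => g1 g2.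
    have -> : (bl 1 i.+1 - bl 1 i = 1)%N by lia.
    by rewrite slice1; split => //; exists (bl 1 i).
  by rewrite (one N).1.
exists i1.+1 => i hi.
have -> : i = (i1.+1 + (i - i1.+1))%N by lia.
have e1 : bl 1 i1.+1 = (bl 1 i1 + size (s (y i1)))%N.
  by rewrite -[i1.+1]addn1 blk_add slice1 /= morph_seq1.
rewrite blk_add e1.
have := size_iter_morph_ge hne 1 (slice y i1.+1 (i - i1.+1)); rewrite size_slice.
have := blk_ge y hne 1 i1; lia.
Qed.

Let Q := (\max_a size (s a))%N.

Let Q_gt0 : (0 < Q)%N.
Proof. by apply: leq_trans (leq_bigmax (y 0%N)); apply: nonerasing_gt0. Qed.

Lemma size_morph_le w : (size (morph s w) <= Q * size w)%N.
Proof.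
elim: w => // a w IH; rewrite morph_cons size_cat /= mulnS leq_add //.
exact: leq_bigmax.
Qed.

Let size_iter_le n w : (size (iter n (morph s) w) <= Q ^ n * size w)%N.
Proof.
elim: n => [|n IH]; first by rewrite expn0 mul1n.
rewrite iterS expnS -mulnA; apply: leq_trans (size_morph_le _) _.
by rewrite leq_mul2l IH orbT.
Qed.

Let letter_le_blk n i : (size (iter n (morph s) [:: y i]) <= bl n i.+1)%N.
Proof. by rewrite -[i.+1]addn1 blk_add slice1 leq_addl. Qed.

Lemma records_steps : exists lam, steps_bounded (record X) lam.
Proof.
have [r0 hr0] := expanding_from.
have [n [S hS]] := record_step hne hfix hr0 Xinf Xgap hasK hasP.
exists ((Q ^ n)%:R * 2), S.+1 => t St rt.
have [t' rt' /andP[tt' h]] := hS t (ltnW St) rt; exists t' => //; split => //.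
rewrite -!natrM ler_nat; apply: leq_trans h _; apply: leq_trans (size_iter_le _ _) _.
rewrite size_mkseq -mulnA leq_mul2l; apply/orP; right; lia.
Qed.

(** The positions [T n] are milestones whose quotients tend to 1: a record between [T m] and
    [T m.+1] is followed by another one no later than [T (m + k.+1)], with [k] fixed. *)
Lemma records_steps_vanishing : Theta = 1 -> steps_vanishing (record X).
Proof.
move=> T1 e e0; have [r0 hr0] := expanding_from.
have [k [S hS]] := record_step hne hfix hr0 Xinf Xgap hasK hasP.
pose T n := bl n i0.+1.
have [l [l0 hl]] : exists l : R, 0 < l /\ (T n)%:R / den n @[n --> \oo] --> l.
  have [l hl] := word_cvg letters (mkseq y i0.+1); exists l; split => //.
  have [l' l'0 hl'] := top; apply: lt_le_trans l'0 _.
  apply: (ler_cvg_to hl' hl); apply: nearW => n.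
  rewrite ler_wpM2r ?invr_ge0 ?mulr_ge0 ?exprn_ge0 ?(ltW Theta0) // ler_nat.
  exact: letter_le_blk.
have den1 : den n / den n.+1 @[n --> \oo] --> (1 : R).
  by apply: (cvgn_lim_eq (l := Theta^-1)); [rewrite T1 invr1|exact: den_ratio].
have ratio m : (T (n + m)%N)%:R / den n @[n --> \oo] --> l.
  elim: m => [|m IH]; first by under eq_fun do rewrite addn0.
  have h := cvgn_succ IH.
  have inv1 : (den n / den n.+1)^-1 @[n --> \oo] --> (1 : R).
    by apply: (cvgn_lim_eq (invr1 _)); apply: cvgV => //; rewrite oner_neq0.
  apply: (@cvgn_eventually_eq _ _ (fun n => (T (n.+1 + m)%N)%:R / den n.+1 *
      (den n / den n.+1)^-1) _ D).
    move=> n Dn; rewrite addSnnS invf_div mulrA divfK // gt_eqF // den_gt0 //; lia.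
  by apply: (cvgn_lim_eq (mulr1 l)); apply: cvgM.
(* Chosen so that [l + el = (1 + e) * (l - el)]. *)
pose el := l * e / (2 + e).
have el0 : 0 < el by rewrite /el divr_gt0 ?mulr_gt0 // ltr_wpDl // ltW.
have elE : el * (2 + e) = l * e.
  by rewrite /el divfK // gt_eqF // addr_gt0.
have /cvgn_distP/(_ _ el0)[N1 h1] := ratio k.+1.
have /cvgn_distP/(_ _ el0)[N2 h2] := hl.
pose N := maxn (maxn N1 N2) D.
exists (maxn S (T N)) => t; rewrite geq_max => /andP[St Nt] rt.
have [t' rt' /andP[tt' h]] := hS t St rt; exists t' => //; split => //.
have [m [Tm Tm1]] : exists m, (T m <= t /\ t < T m.+1)%N.
  have ex : exists m, (t < T m.+1)%N.
    have [M hM] := top_infty t.+1; exists M.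
    apply: (leq_trans (hM M.+1 (leqnSn M))).
    exact: letter_le_blk.
  case: (ex_minnP ex) => m hm min; exists m; split => //.
  case: m hm min => [|m] hm min.
    by apply: leq_trans Nt; apply: blk_mono_iter.
  by rewrite leqNgt; apply/negP => /min; rewrite ltnn.
have Nm : (N <= m)%N.
  rewrite leqNgt; apply/negP => mN; have : (T m.+1 <= T N)%N by apply: blk_mono_iter.
  lia.
have {}h : (t' <= T (m + k.+1))%N.
  apply: leq_trans h _; rewrite addnS -addSn addnC /T (blkD hfix).
  exact: blk_mono.
have Dm : (D <= m)%N by rewrite /N in Nm; lia.
have := h1 m ltac:(rewrite /N in Nm; lia); have := h2 m ltac:(rewrite /N in Nm; lia).
rewrite !ler_norml => /andP[g1 _] /andP[_ g2].
have dm := den_gt0 Dm.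
have {}g1 : (l - el) * den m <= t%:R.
  apply: (@le_trans _ _ (T m)%:R); last by rewrite ler_nat.
  by rewrite -ler_pdivlMr //; lra.
have {}g2 : t'%:R <= (l + el) * den m.
  apply: (@le_trans _ _ (T (m + k.+1)%N)%:R); first by rewrite ler_nat.
  by rewrite -ler_pdivrMr //; lra.
apply: le_trans g2 _; apply: (@le_trans _ _ ((1 + e) * ((l - el) * den m))).
  rewrite [leRHS]mulrA ler_wpM2r ?(ltW dm) //; move: elE; lra.
by rewrite ler_wpM2l //; move: e0; lra.
Qed.

Lemma records_positions : 1 < Theta -> exp_poly_positions (record X) D Theta.
Proof.
move=> T1; have [r0 hr0] := expanding_from.
have [J hJ] := record_last_pos hne hfix hr0 Xinf.
pose pos j n := last_pos P (iter n (morph s) (mkseq y j.+1)).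
have /choice[gam hgam] : forall j, exists l : R,
    (pos j n)%:R / (C n D * Theta ^+ n) @[n --> \oo] --> l.
  by move=> j; apply: (last_pos_cvg T1 letters hasK hasP).
(* An occurrence counted at [M] or beyond has its parent to the right of [i0], so the images of
   [y i0] bound the later positions from below and force a positive limit. The threshold [J.+2]
   excludes [n = 0], where positions are at most [J.+1]. *)
pose M := (bl 1 i0.+2).+1.
pose rel j := `[< exists n, (M <= pos j n.+1)%N >].
exists J.+1, pos, gam, rel, (maxn M J.+2); split.
  move=> j /asboolP[n0 hn0]; split => //.
  set p := pos j n0.+1 in hn0.
  have hasp : has P (iter n0.+1 (morph s) (mkseq y j.+1)).
    by apply/negPn/negP => /last_pos0; rewrite -/(pos j n0.+1) -/p => p0; rewrite p0 in hn0.
  have [v [a [v' [E Pa _ pE]]]] := last_pos_split hasp.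
  rewrite -/(pos j n0.+1) -/p in pE.
  rewrite (iter_morph_prefix hfix) in E.
  have szE : (bl n0.+1 j.+1 = size v + (size v').+1)%N.
    by have := congr1 size E; rewrite size_mkseq size_cat.
  have yp : X (size v).
    have := congr1 (fun w => nth a w (size v)) E.
    by rewrite /= nth_cat ltnn subnn nth_mkseq /X => [->|] //; lia.
  have pb : (size v < bl 1 (bl n0 j.+1))%N by rewrite -(blkD hfix) add1n; lia.
  have [i hi] := ancestor y hne 1 (size v).
  have i0i : (i0 < i)%N.
    rewrite ltnNge; apply/negP => ii; have := blk_mono s y 1 (ii : (i.+1 <= i0.+1)%N).
    have := blk_mono s y 1 (leqnSn i0.+1); rewrite /M in hn0; lia.
  have ib : (i < bl n0 j.+1)%N.
    by rewrite -(blk_ltE y hne 1); lia.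
  have Ki : K (y i).
    rewrite -hasP; have := iter_morph_letter hfix 1 i; rewrite /= morph_seq1 => ->.
    by apply/has_slice; exists (size v); split => //; lia.
  have lower n : (0 < n)%N -> (size (iter n (morph s) [:: y i0]) <= pos j (n + n0))%N.
    case: n => // n _; rewrite /pos iterD (iter_morph_prefix hfix n0).
    have Es : mkseq y (bl n0 j.+1) =
        mkseq y i ++ (y i :: slice y i.+1 (bl n0 j.+1 - i.+1)).
      rewrite -slice_cons -!slice0.
      have {1}-> : bl n0 j.+1 = (i + (bl n0 j.+1 - i.+1).+1)%N by lia.
      by rewrite slice_add add0n.
    set w := slice _ i.+1 _ in Es *.
    have hw : has P (iter n.+1 (morph s) (y i :: w)).
      by rewrite (has_iter_morph hasK hasP) /= Ki.
    rewrite Es iter_morph_cat last_pos_cat hw; apply: leq_trans (leq_addr _ _).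
    have -> : mkseq y i = mkseq y i0 ++ (slice y i0 1 ++ slice y (i0 + 1) (i - (i0 + 1))).
      rewrite -slice_add -!slice0.
      have {1}-> : i = (i0 + (1 + (i - (i0 + 1))))%N by lia.
      by rewrite slice_add add0n.
    rewrite !iter_morph_cat !size_cat slice1 addnCA; exact: leq_addr.
  have [l l0 hl] := top.
  have Q0 : 0 < (Q ^ n0)%:R :> R by rewrite ltr0n expn_gt0 Q_gt0.
  (* Dropping [n0] iterations divides lengths by at most [Q ^ n0]. *)
  have : l / (Q ^ n0)%:R <= gam j.
    apply: (ler_cvg_to (cvgMr_tmp (b := (Q ^ n0)%:R^-1) hl) (hgam j)).
    exists (n0.+1) => // n /= hn; rewrite mulrAC ler_wpM2r ?invr_ge0 ?mulr_ge0 ?exprn_ge0 ?(ltW Theta0) //.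
    rewrite ler_pdivrMr // -natrM ler_nat.
    have -> : n = (n - n0 + n0)%N by lia.
    apply: (@leq_trans (Q ^ n0 * size (iter (n - n0) (morph s) [:: y i0]))).
      by rewrite addnC iterD; apply: size_iter_le.
    by rewrite mulnC leq_mul2r lower ?orbT //; lia.
  by apply: lt_le_trans; rewrite divr_gt0.
move=> t; rewrite geq_max => /andP[Mt Jt] rt.
have [n [i [iJ tE]]] := hJ t rt ltac:(lia).
exists i, n; split => //; apply/asboolP.
case: n tE => [|n] tE; last by exists n; rewrite /pos -tE.
have := last_pos_size P (mkseq y i.+1); rewrite size_mkseq.
have : t = last_pos P (mkseq y i.+1) := tE; lia.
Qed.

End RecordAsymptotics.

(** * Comparison of two descriptions of the records *)

Section LogarithmicScale.
Variable R : realType.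
Implicit Types (rec : nat -> Prop) (lam mu e : R).

Lemma ln_nat_infty (X : R) : exists N, (1 < N)%N /\ forall n, (N <= n)%N -> X <= ln (n%:R : R).
Proof.
have [N hN] := exists_nat_ge (expR X); exists (maxn N 2); split; first by rewrite leq_max orbT.
move=> n; rewrite geq_max => /andP[/hN h n2].
rewrite -[X]expRK ler_ln ?posrE ?expR_gt0 //.
by rewrite ltr0n (leq_trans _ n2).
Qed.

Lemma lnln_nat_infty (X : R) : exists N, (2 < N)%N /\
  forall n, (N <= n)%N -> 1 <= ln (n%:R : R) /\ X <= ln (ln n%:R).
Proof.
have [N [_ hN]] := ln_nat_infty (Num.max 1 (expR X)).
exists (maxn N 3); split; first by rewrite leq_max orbT.
move=> n; rewrite geq_max => /andP[/hN]; rewrite ge_max => /andP[h1 h2] _.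
split => //; rewrite -[X]expRK ler_ln ?posrE ?expR_gt0 //.
exact: lt_le_trans h1.
Qed.

Lemma lnln_diff (x y : R) : 0 < x -> x <= y -> ln y - ln x <= (y - x) / x.
Proof.
move=> x0 xy; have y0 : 0 < y by apply: lt_le_trans xy.
rewrite -ln_div ?posrE //; have -> : y / x = 1 + (y - x) / x.
  by rewrite mulrBl divff ?gt_eqF // addrC subrK.
apply: le_ln1Dx; apply: (@lt_le_trans _ _ 0); first by rewrite ltrN10.
by rewrite divr_ge0 ?(ltW x0) // subr_ge0.
Qed.

Lemma ln_nat_le t t' : (0 < t)%N -> (t <= t')%N -> ln (t%:R : R) <= ln t'%:R.
Proof. by move=> t0 tt; rewrite ler_ln ?posrE ?ltr0n ?(leq_trans t0) // ler_nat. Qed.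

Lemma ln_nat_over_cvg0 : ln (n%:R : R) / n%:R @[n --> \oo] --> (0 : R).
Proof.
apply/cvgn_distP => e e0.
have x01 : 0 <= expR (- e) < 1 by rewrite expR_ge0 expR_lt1 oppr_lt0.
have /cvgn_distP/(_ 1 ltr01)[N hN] := @bin_exp_cvg0 R 1 _ x01.
exists (maxn N 1) => n; rewrite geq_max => /andP[/hN]; rewrite bin1 !subr0 => h n0.
have n0' : 0 < n%:R :> R by rewrite ltr0n.
have h1 : n%:R <= expR e ^+ n.
  move: h; rewrite ger0_norm ?mulr_ge0 ?exprn_ge0 ?expR_ge0 // expRN exprVn.
  by rewrite ler_pdivrMr ?exprn_gt0 ?expR_gt0 // mul1r.
rewrite ger0_norm; last by rewrite divr_ge0 // ln_ge0 // ler1n.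
rewrite ler_pdivrMr //; have := h1; rewrite -ler_ln ?posrE ?exprn_gt0 ?expR_gt0 //.
by rewrite lnXn ?expR_gt0 // expRK mulr_natr.
Qed.

Lemma pigeonhole (T : finType) (g : nat -> T) :
  exists i j, [/\ (i < j)%N, (j <= #|T|)%N & g i = g j].
Proof.
case: (pselect (injective (fun i : 'I_#|T|.+1 => g i))) => [inj|no].
  by have := leq_card _ inj; rewrite card_ord ltnn.
have [i [j [ij E]]] : exists i j : 'I_#|T|.+1, i != j /\ g i = g j.
  apply: contrapT => h; apply: no => i j E; apply/eqP/negPn/negP => ij.
  by apply: h; exists i, j.
have [i1 j1] : (i <= #|T|)%N /\ (j <= #|T|)%N by split; rewrite -ltnS.
case: (ltngtP i j) => [h|h|/val_inj h]; [by exists i, j|by exists j, i|].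
by rewrite h eqxx in ij.
Qed.

Lemma record_chain rec lam S t0 : (forall t, (S <= t)%N -> rec t ->
    exists2 t', rec t' & (t < t')%N /\ t'%:R <= lam * t%:R) ->
  (S <= t0)%N -> rec t0 -> exists f : nat -> nat, [/\ f 0%N = t0,
    forall i, rec (f i) /\ (S <= f i)%N & forall i, (f i < f i.+1)%N /\ (f i.+1)%:R <= lam * (f i)%:R].
Proof.
move=> h St0 rt0.
have /choice[nxt hn] : forall t, exists t', (S <= t)%N -> rec t ->
    rec t' /\ ((t < t')%N /\ t'%:R <= lam * t%:R).
  move=> t; case: (pselect ((S <= t)%N /\ rec t)) => [[St rt]|no].
    by have [t' r' hh] := h t St rt; exists t'.
  by exists 0%N => St rt; case: no.
exists (fun i => iter i nxt t0).
have inv i : rec (iter i nxt t0) /\ (S <= iter i nxt t0)%N.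
  elim: i => [|i [r1 s1]] //=; have [r2 [h1 _]] := hn _ s1 r1.
  by split => //; apply: leq_trans s1 (ltnW h1).
by split => // i; have [r1 s1] := inv i; have [_] := hn _ s1 r1.
Qed.

Lemma chain_mono (f : nat -> nat) : (forall i, (f i < f i.+1)%N) ->
  forall i j, (i < j)%N -> (f i < f j)%N.
Proof.
move=> h i j /subnKC <-; elim: (j - i.+1)%N => [|k IH]; first by rewrite addn0.
by rewrite addnS; apply: ltn_trans IH (h _).
Qed.

Lemma chain_ln lam (f : nat -> nat) : 1 <= lam -> (0 < f 0)%N ->
  (forall i, (f i < f i.+1)%N /\ (f i.+1)%:R <= lam * (f i)%:R) ->
  forall i j, (i <= j)%N -> ln ((f j)%:R : R) - ln (f i)%:R <= (j - i)%:R * ln lam.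
Proof.
move=> l1 f0 h i j /subnKC {1}<-.
have fp k : (0 < f k)%N by elim: k => // k IH; apply: leq_ltn_trans (h k).1.
elim: (j - i)%N => [|k IH]; first by rewrite addn0 subrr mul0r.
have l0 : 0 < lam by apply: lt_le_trans l1.
have := (h (i + k)%N).2; rewrite -addnS -ler_ln ?posrE ?mulr_gt0 ?ltr0n //.
rewrite lnM ?posrE ?ltr0n // => h2.
rewrite -natr1 mulrDl mul1r; lra.
Qed.

(* Up to a vanishing error, the numbers [ln t - D * ln (ln t)], [t] in [rec], lie
   on finitely many arithmetic progressions of difference [lam]. *)
Definition labelled rec (D : nat) lam (T : finType) (c : T -> R)
    (lab : nat -> T) (num : nat -> nat) (S0 : nat) :=
  (forall t t', (S0 <= t)%N -> (S0 <= t')%N -> rec t -> rec t' ->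
    lab t = lab t' -> num t = num t' -> t = t') /\
  forall e, 0 < e -> exists S, forall t, (S <= t)%N -> rec t ->
    `|ln (t%:R : R) - D%:R * ln (ln t%:R) - c (lab t) - (num t)%:R * lam| <= e.

(** The logarithm of [pos n] is [n ln Theta + D ln n] plus a convergent term. In particular it is
    equivalent to [n ln Theta], so [ln n] can be traded for [ln (ln (pos n))] minus
    [ln (ln Theta)]. *)
Lemma exp_poly_log (pos : nat -> nat) (D : nat) (Theta gam : R) : 1 < Theta -> 0 < gam ->
  (pos n)%:R / ('C(n, D)%:R * Theta ^+ n) @[n --> \oo] --> gam -> exists c : R,
  ln ((pos n)%:R : R) - D%:R * ln (ln (pos n)%:R) - n%:R * ln Theta @[n --> \oo] --> c.
Proof.
move=> T1 g0 hp; have [l l0 hl] := bin_exp_ratio R D.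
have T0 : 0 < Theta by apply: lt_trans T1.
have lT : 0 < ln Theta by apply: ln_gt0.
have lT0 : ln Theta != 0 by rewrite gt_eqF.
have gl : 0 < gam * l by rewrite mulr_gt0.
have hpn : (pos n)%:R / (n%:R ^+ D * Theta ^+ n) @[n --> \oo] --> gam * l.
  apply: (@cvgn_eventually_eq _ _ (fun n => (pos n)%:R / ('C(n, D)%:R * Theta ^+ n) *
     ('C(n, D)%:R / n%:R ^+ D)) _ D.+1); last exact: cvgM.
  move=> n Dn; have c0 : 'C(n, D)%:R != 0 :> R by rewrite pnatr_eq0 -lt0n bin_gt0 ltnW.
  have n0 : n%:R ^+ D != 0 :> R by rewrite expf_neq0 // pnatr_eq0; lia.
  have t0 : Theta ^+ n != 0 by rewrite expf_neq0 // gt_eqF.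
  by field; rewrite n0 c0 t0.
have gl2 : 0 < gam * l / 2 by rewrite divr_gt0.
have [N0 hN0] : exists N, forall n, (N <= n)%N -> (0 < n)%N /\ (0 < pos n)%N.
  have /cvgn_distP/(_ _ gl2)[N hN] := hpn.
  exists (maxn N 1) => n; rewrite geq_max => /andP[/hN h n0]; split => //.
  rewrite lt0n; apply/negP => /eqP E; move: h; rewrite E mul0r sub0r normrN.
  by rewrite ger0_norm ?(ltW gl) // => h; lra.
pose x n : R := ln (pos n)%:R; pose z n : R := n%:R.
have h1 : x n - D%:R * ln (z n) - n%:R * ln Theta @[n --> \oo] --> ln (gam * l).
  have hln : ln ((pos n)%:R / (n%:R ^+ D * Theta ^+ n)) @[n --> \oo] --> ln (gam * l).
    by apply: continuous_cvg hpn; apply: continuous_ln.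
  apply: (cvgn_eventually_eq _ hln (N := N0)) => n /hN0[n0 p0].
  have n0' : 0 < n%:R :> R by rewrite ltr0n.
  rewrite ln_div ?posrE ?mulr_gt0 ?exprn_gt0 ?ltr0n // lnM ?posrE ?exprn_gt0 //.
  rewrite !lnXn // -[ln n%:R *+ D]mulr_natl -[ln Theta *+ n]mulr_natl /x /z; ring.
have inv0 : (n%:R : R)^-1 @[n --> \oo] --> (0 : R) by apply/cvgn_inv/exists_nat_ge.
have h2 : x n / n%:R @[n --> \oo] --> ln Theta.
  apply: (@cvgn_eventually_eq _ _ (fun n => (x n - D%:R * ln (z n) - n%:R * ln Theta) *
     n%:R^-1 + D%:R * (ln n%:R / n%:R) + ln Theta) _ 1).
    by move=> n n0; have nz : n%:R != 0 :> R by [rewrite pnatr_eq0; lia]; rewrite /z; field.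
  apply: (cvgn_lim_eq (l := ln (gam * l) * 0 + D%:R * 0 + ln Theta)).
    by rewrite !mulr0 !add0r.
  apply: cvgD; last exact: cvg_cst; apply: cvgD; first exact: cvgM.
  by apply: cvgMl_tmp; exact: ln_nat_over_cvg0.
have h3 : ln (x n) - ln (z n) @[n --> \oo] --> ln (ln Theta).
  have hln : ln (x n / n%:R) @[n --> \oo] --> ln (ln Theta).
    by apply: continuous_cvg h2; apply: continuous_ln.
  have lT2 : 0 < ln Theta / 2 by rewrite divr_gt0.
  have /cvgn_distP/(_ _ lT2)[N hN] := h2.
  apply: (cvgn_eventually_eq _ hln (N := maxn N 1)) => n.
  rewrite geq_max => /andP[/hN h n0]; have n0' : 0 < n%:R :> R by rewrite ltr0n.
  rewrite ln_div ?posrE //; move: h; rewrite ler_norml => /andP[h _].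
  have : 0 < x n / n%:R by lra.
  by rewrite pmulr_lgt0 // invr_gt0.
exists (ln (gam * l) - D%:R * ln (ln Theta)).
apply: (@cvgn_eventually_eq _ _ (fun n => (x n - D%:R * ln (z n) - n%:R * ln Theta) -
  D%:R * (ln (x n) - ln (z n))) _ 0); first by move=> n _; rewrite /x /z; ring.
by apply: cvgB => //; apply: cvgMl_tmp.
Qed.

(** The label of a record is the index [j] of its sequence, its number the exponent [n]. *)
Lemma positions_labelled rec D (Theta : R) : 1 < Theta -> exp_poly_positions rec D Theta ->
  exists (T : finType) (c : T -> R) lab num S0, labelled rec D (ln Theta) c lab num S0.
Proof.
move=> T1 [J [pos [gam [rel [S [hpos hrec]]]]]].
have /choice[c hc] : forall j, exists c : R, rel j ->
    ln ((pos j n)%:R : R) - D%:R * ln (ln (pos j n)%:R) - n%:R * ln Theta @[n --> \oo] --> c.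
  move=> j; case: (boolP (rel j)) => [rj|_]; last by exists 0.
  by have [g0 hg] := hpos j rj; have [c hc] := exp_poly_log T1 g0 hg; exists c.
have /choice[jn hjn] : forall t, exists jn : nat * nat, (S <= t)%N -> rec t ->
    [/\ (jn.1 < J)%N, rel jn.1 & t = pos jn.1 jn.2].
  move=> t; case: (pselect ((S <= t)%N /\ rec t)) => [[St rt]|no].
    by have [j [n h]] := hrec t St rt; exists (j, n).
  by exists (0, 0)%N => St rt; case: no.
have lab_val t : (S <= t)%N -> rec t -> (inord (jn t).1 : 'I_J.+1) = (jn t).1 :> nat.
  by move=> St rt; have [h _ _] := hjn t St rt; rewrite inordK // ltnW.
exists 'I_J.+1, (fun j : 'I_J.+1 => c j), (fun t => inord (jn t).1), (fun t => (jn t).2), S.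
split => [t t' St St' rt rt' E1 E2|e e0].
  have [_ _ ->] := hjn t St rt; have [_ _ ->] := hjn t' St' rt'.
  by rewrite E2 -(lab_val t) // E1 lab_val.
have [N hN] : exists N, forall (j : 'I_J) n, (N <= n)%N -> rel j ->
    `|ln ((pos j n)%:R : R) - D%:R * ln (ln (pos j n)%:R) - n%:R * ln Theta - c j| <= e.
  apply: (@finite_eventually _ (fun (j : 'I_J) n => rel j ->
    `|ln ((pos j n)%:R : R) - D%:R * ln (ln (pos j n)%:R) - n%:R * ln Theta - c j| <= e)).
  move=> j; case: (boolP (rel j)) => rj; last by exists 0%N.
  by have /cvgn_distP/(_ e e0)[N hN] := hc j rj; exists N => n /hN.
(* Records beyond this bound have an exponent at least [N]. *)
exists (maxn S (\max_(j < J) \max_(n < N) pos j n).+1) => t.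
rewrite geq_max => /andP[St Mt] rt; have [jJ rj tE] := hjn t St rt.
rewrite lab_val // {1 2}tE.
have Nn : (N <= (jn t).2)%N.
  rewrite leqNgt; apply/negP => nN; move: Mt; apply/negP; rewrite -leqNgt {1}tE.
  apply: leq_trans (leq_bigmax (Ordinal jJ)).
  exact: (leq_bigmax (F := fun n : 'I_N => pos (jn t).1 n) (Ordinal nN)).
have := hN (Ordinal jJ) _ Nn rj; rewrite /=.
by rewrite -!addrA [- c _ + _]addrC.
Qed.

Section SameLabel.
Variables (rec : nat -> Prop) (D : nat) (lam : R) (T : finType) (c : T -> R).
Variables (lab : nat -> T) (num : nat -> nat) (S0 : nat).
Hypothesis hl : labelled rec D lam c lab num S0.
Hypothesis lam0 : 0 < lam.

(** While [ln t] moves by at most [Delta], the term [D * ln (ln t)] moves by at most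
    [D * Delta / ln t], so only the difference of the numbers remains. It is nonzero by the
    injectivity in [labelled], and not negative because [t < t'] and [e < lam]. *)
Lemma same_label_gap (Delta e : R) : 0 <= Delta -> 0 < e -> e < lam -> exists S,
  forall t t', (S <= t)%N -> (t < t')%N -> rec t -> rec t' ->
  ln (t'%:R : R) - ln t%:R <= Delta -> lab t = lab t' ->
  exists2 k, (0 < k)%N & `|ln (t'%:R : R) - ln t%:R - k%:R * lam| <= e.
Proof.
move=> D0 e0 el; have [inj app] := hl; have e4 : 0 < e / 4 by rewrite divr_gt0.
have [S hS] := app _ e4.
have [N [N1 hN]] := ln_nat_infty (Num.max 1 (D%:R * Delta / (e / 2))).
exists (maxn (maxn S N) S0) => t t'; rewrite !geq_max -andbA => /and3P[St Nt S0t] tt rt rt' hD E.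
have tt' := ltnW tt.
have := hS t St rt; have := hS t' (leq_trans St tt') rt'; rewrite -E.
have := hN t Nt; rewrite ge_max => /andP[l1 l2].
have lt0 : 0 < ln (t%:R : R) by apply: lt_le_trans l1.
have lnm : ln (t%:R : R) <= ln t'%:R.
  by apply: ln_nat_le => //; apply: leq_trans Nt; exact: ltnW.
have d1 := lnln_diff lt0 lnm.
have d0 : 0 <= ln (ln (t'%:R : R)) - ln (ln t%:R).
  by rewrite subr_ge0 ler_ln ?posrE // (lt_le_trans lt0).
have e2 : 0 < e / 2 by rewrite divr_gt0.
have d2 : D%:R * (ln (ln (t'%:R : R)) - ln (ln t%:R)) <= e / 2.
  apply: (@le_trans _ _ (D%:R * (Delta / ln t%:R))).
    rewrite ler_wpM2l //; apply: le_trans d1 _.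
    by rewrite ler_wpM2r // invr_ge0 ltW.
  by rewrite mulrA ler_pdivrMr // [leRHS]mulrC -ler_pdivrMr.
have d3 : 0 <= D%:R * (ln (ln (t'%:R : R)) - ln (ln t%:R)) by rewrite mulr_ge0.
rewrite mulrBr in d2 d3.
set a := ln t'%:R in d2 d3 lnm hD *; set b := ln t%:R in d2 d3 lnm hD *.
set a2 := D%:R * ln a in d2 d3 *; set b2 := D%:R * ln b in d2 d3 *.
rewrite !ler_norml => /andP[g1 g2] /andP[g3 g4].
have nn : (num t < num t')%N.
  rewrite ltn_neqAle; apply/andP; split.
    apply/eqP => En; have : t = t' by apply: inj => //; apply: leq_trans tt'.
    by move=> Et; rewrite Et ltnn in tt.
  rewrite leqNgt; apply/negP => h.
  have : (num t')%:R * lam + lam <= (num t)%:R * lam.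
    by rewrite -[X in _ + X]mul1r -mulrDl natr1 ler_wpM2r ?(ltW lam0) // ler_nat.
  lra.
exists (num t' - num t)%N; first by rewrite subn_gt0.
rewrite natrB ?(ltnW nn) // mulrBl ler_norml; apply/andP; split; lra.
Qed.

End SameLabel.

(* Many records within a short range: two of them have the same label. *)
Lemma vanishing_vs_labelled rec D lam (T : finType) (c : T -> R) lab num S0 :
  (forall n, exists2 t, rec t & (n <= t)%N) -> 0 < lam -> steps_vanishing R rec ->
  ~ labelled rec D lam c lab num S0.
Proof.
move=> unb l0 van hl.
have l4 : 0 < lam / 4 by rewrite divr_gt0.
have l4' : lam / 4 < lam by rewrite ltr_pdivrMr // ltr_pMr // ltr1n.
have [S1 h1] := same_label_gap hl l0 (ltW l4) l4 l4'.
(* [M.+1] steps of quotient at most [1 + e] move the logarithm by at most [lam / 4], whereas a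
   common label forces a distance of at least [lam - lam / 4]. *)
pose M := #|T|; pose e := lam / 4 / M.+1%:R.
have M0 : 0 < M.+1%:R :> R by rewrite ltr0n.
have e0 : 0 < e by rewrite divr_gt0.
have [S2 h2] := van e e0.
have [t0 rt0] := unb (maxn (maxn S1 S2) 1); rewrite !geq_max -andbA => /and3P[St1 St2 t1].
have [f [f0 fr fs]] := record_chain h2 St2 rt0.
have [i [j [ij jM E]]] := pigeonhole (fun i => lab (f i)).
have fij := chain_mono (fun i => (fs i).1) ij.
have f0i : (f 0%N <= f i)%N.
  by case: (i) => // i'; apply/ltnW/(chain_mono (fun i => (fs i).1)).
have lnf : ln ((f j)%:R : R) - ln (f i)%:R <= lam / 4.
  have e1 : 1 <= 1 + e by rewrite lerDl ltW.
  have f0' : (0 < f 0)%N by rewrite f0.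
  apply: le_trans (chain_ln e1 f0' fs (ltnW ij)) _.
  have lne : ln (1 + e) <= e by apply: le_ln1Dx; apply: lt_trans e0; rewrite ltrN10.
  apply: (@le_trans _ _ (M.+1%:R * e)); last by rewrite /e mulrC divfK ?gt_eqF.
  by apply: ler_pM => //; [exact: ln_ge0|rewrite ler_nat; lia].
have [k k0] := h1 (f i) (f j) ltac:(lia) fij (fr i).1 (fr j).1 lnf E.
have : lam <= k%:R * lam by rewrite ler_peMl ?(ltW l0) // ler1n.
have l2 : ln ((f i)%:R : R) <= ln (f j)%:R by apply: ln_nat_le; lia.
rewrite ler_norml => g1 /andP[g2 _]; lra.
Qed.

Lemma steps_bounded_ge1 rec lam : steps_bounded rec lam ->
  exists2 lam' : R, 1 <= lam' & steps_bounded rec lam'.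
Proof.
move=> [S hS]; exists (Num.max 1 lam); first by rewrite le_max lexx.
exists S => t St rt; have [t' rt' [tt h]] := hS t St rt; exists t' => //; split => //.
by apply: le_trans h _; rewrite ler_wpM2r // le_max lexx orbT.
Qed.

(** * One set of records described by two labellings *)

Section TwoLabellings.
Variables (rec : nat -> Prop) (bnd : R).
Hypothesis unb : forall n, exists2 t, rec t & (n <= t)%N.
Hypothesis steps : steps_bounded rec bnd.
Hypothesis bnd1 : 1 <= bnd.
Variables (d : nat) (lam : R) (T : finType) (c : T -> R) (lab : nat -> T).
Variables (num : nat -> nat) (S0 : nat).
Variables (d' : nat) (lam' : R) (T' : finType) (c' : T' -> R) (lab' : nat -> T').
Variables (num' : nat -> nat) (S0' : nat).
Hypothesis hl : labelled rec d lam c lab num S0.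
Hypothesis hl' : labelled rec d' lam' c' lab' num' S0'.
Hypothesis lam0 : 0 < lam.
Hypothesis lam'0 : 0 < lam'.

Let bnd0 : 0 < bnd. Proof. exact: lt_le_trans bnd1. Qed.

(** Among [#|{: T * T'}|.+1] successive records two share both labels; the distance of their
    logarithms is bounded independently of [e] and close to multiples of both [lam] and [lam']. *)
Let near_dependent (e : R) : 0 < e -> e < lam -> e < lam' -> exists k l,
  [/\ (0 < k)%N, (0 < l)%N, k%:R * lam <= #|{: T * T'}|%:R * ln bnd + e,
    l%:R * lam' <= #|{: T * T'}|%:R * ln bnd + e & `|k%:R * lam - l%:R * lam'| <= e + e].
Proof.
move=> e0 el el'; pose Delta : R := #|{: T * T'}|%:R * ln bnd.
have Delta0 : 0 <= Delta by rewrite mulr_ge0 // ln_ge0.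
have [S1 h1] := same_label_gap hl lam0 Delta0 e0 el.
have [S2 h2] := same_label_gap hl' lam'0 Delta0 e0 el'.
have [S hS] := steps.
have [t0 rt0] := unb (maxn (maxn S1 S2) (maxn S 1)).
rewrite !geq_max -!andbA => /and4P[St1 St2 St t1].
have [f [f0 fr fs]] := record_chain hS St rt0.
have [i [j [ij jM E]]] := pigeonhole (fun i => (lab (f i), lab' (f i))).
have fij := chain_mono (fun i => (fs i).1) ij.
have f0i : (f 0%N <= f i)%N.
  by case: (i) => // i'; apply/ltnW/(chain_mono (fun i => (fs i).1)).
have lnf : ln ((f j)%:R : R) - ln (f i)%:R <= Delta.
  have f0' : (0 < f 0)%N by rewrite f0.
  apply: le_trans (chain_ln bnd1 f0' fs (ltnW ij)) _.
  by rewrite ler_wpM2r ?ln_ge0 // ler_nat; exact: leq_trans (leq_subr _ _) jM.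
have [E1 E2] := (congr1 fst E, congr1 snd E).
rewrite f0 in f0i.
have [k k0 g1] := h1 _ _ (leq_trans St1 f0i) fij (fr i).1 (fr j).1 lnf E1.
have [l l0 g2] := h2 _ _ (leq_trans St2 f0i) fij (fr i).1 (fr j).1 lnf E2.
move: g1 g2; rewrite !ler_norml => /andP[g1 g2] /andP[g3 g4].
exists k, l; split => //; rewrite -/Delta; [lra|lra|].
rewrite ler_norml; apply/andP; split; lra.
Qed.

(** The multipliers are bounded independently of the tolerance, so only finitely many values of
    [k lam - l lam'] compete; a tolerance below the nonzero ones forces a zero. *)
Lemma labelled_dependent : exists k l,
  [/\ (0 < k)%N, (0 < l)%N & k%:R * lam = l%:R * lam'].
Proof.
apply: contrapT => no; pose Delta : R := #|{: T * T'}|%:R * ln bnd.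
have [K hK] := exists_nat_ge ((Delta + lam) / lam).
have [L hL] := exists_nat_ge ((Delta + lam') / lam').
have [|e /andP[e0 _] he] := @finite_lower_bound ('I_K.+1 * 'I_L.+1)%type R
  (fun p => if (0 < p.1)%N && (0 < p.2)%N then `|p.1%:R * lam - p.2%:R * lam'| else 1).
  move=> [k l] /=; case: ifP => // /andP[k0 l0]; rewrite normr_gt0 subr_eq0.
  by apply/eqP => E; apply: no; exists k, l.
pose e' := Num.min (e / 4) (Num.min (lam / 2) (lam' / 2)).
have e'0 : 0 < e' by rewrite !lt_min !divr_gt0.
have [e'1 [e'2 e'3]] : e' <= e / 4 /\ (e' <= lam / 2 /\ e' <= lam' / 2).
  by rewrite /e' !ge_min !lexx !orbT.
have [||k [l [k0 l0 hk hl2 hkl]]] := near_dependent e'0; [lra|lra|].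
have kK : (k < K.+1)%N.
  rewrite ltnS -(ler_nat R); apply: le_trans (hK K (leqnn K)).
  by rewrite ler_pdivlMr // /Delta; lra.
have lL : (l < L.+1)%N.
  rewrite ltnS -(ler_nat R); apply: le_trans (hL L (leqnn L)).
  by rewrite ler_pdivlMr // /Delta; lra.
have := he (Ordinal kK, Ordinal lL); rewrite /= k0 l0 /=; lra.
Qed.

(** Steps bounded on the logarithmic scale tend to 0 on the doubly logarithmic one, so a chain of
    large records skips no interval of length [e]. *)
Lemma lnln_dense (e : R) N : 0 < e -> exists X0, forall X, X0 <= X ->
  exists t, [/\ rec t, (N <= t)%N & X <= ln (ln (t%:R : R)) <= X + e].
Proof.
move=> e0; have [S hS] := steps.
have [N1 [N11 hN1]] := ln_nat_infty (Num.max 1 (ln bnd / e)).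
have [t0 rt0] := unb (maxn (maxn S N) N1).
rewrite !geq_max -andbA => /and3P[St Nt N1t].
exists (ln (ln t0%:R)) => X hX.
have [f [f0 fr fs]] := record_chain hS St rt0.
have f0i i : (t0 <= f i)%N.
  by rewrite -f0; case: i => // i; apply/ltnW/(chain_mono (fun i => (fs i).1)).
have grow i : (i <= f i)%N.
  by elim: i => // i IH; apply: leq_ltn_trans IH (fs i).1.
have ex : exists i, X <= ln (ln ((f i)%:R : R)).
  have [M [_ hM]] := lnln_nat_infty X; exists M.
  by have [_] := hM (f M) (grow M).
case: (ex_minnP ex) => i hi min; exists (f i); split.
- exact: (fr i).1.
- exact: leq_trans Nt (f0i i).
rewrite hi /=; case: i hi min => [|i] hi min.
  by rewrite f0; apply: le_trans hX _; rewrite lerDl ltW.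
have lo : ln (ln ((f i)%:R : R)) < X.
  by rewrite ltNge; apply/negP => /min; rewrite ltnn.
have := hN1 (f i) (leq_trans N1t (f0i i)); rewrite ge_max => /andP[l1 l2].
have lf0 : 0 < ln ((f i)%:R : R) by apply: lt_le_trans l1.
have fp k : (0 < f k)%N by apply: leq_trans (f0i k); apply: leq_trans N1t; exact: ltnW.
have lm : ln ((f i)%:R : R) <= ln (f i.+1)%:R by apply: ln_nat_le; [exact: fp|exact: ltnW (fs i).1].
have d1 := lnln_diff lf0 lm.
have d2 : ln ((f i.+1)%:R : R) - ln (f i)%:R <= ln bnd.
  have := (fs i).2; rewrite -ler_ln ?posrE ?mulr_gt0 ?ltr0n ?fp //.
  by rewrite lnM ?posrE ?ltr0n ?fp // lerBlDr.
have d3 : (ln ((f i.+1)%:R : R) - ln (f i)%:R) / ln (f i)%:R <= e.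
  by rewrite ler_pdivrMr // mulrC -ler_pdivrMr //; apply: le_trans l2; rewrite ler_wpM2r ?invr_ge0 ?(ltW e0).
lra.
Qed.

(** Subtracting the two descriptions puts [(d' - d) * ln (ln t)] close to finitely many cosets of
    the group generated by [lam1], one per pair of labels, against the density of the values
    [ln (ln t)]. *)
Lemma labelled_same_degree k l lam1 : 0 < lam1 -> lam = l%:R * lam1 -> lam' = k%:R * lam1 ->
  ~ (d < d')%N.
Proof.
move=> lam10 El Ek dd; have [_ app] := hl; have [_ app'] := hl'.
pose M := #|{: T * T'}|; pose kap : R := (d' - d)%:R.
have kap0 : 0 < kap by rewrite ltr0n subn_gt0.
have kapE : kap = d'%:R - d%:R by rewrite /kap natrB // ltnW.
(* [M.+1] targets spaced by [del] span less than [lam1 / 2]. The errors, [del / 4] from the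
   positions and four times [del / 16] from the labellings, keep the multiple of [lam1] found below
   strictly between 0 and [lam1]. *)
pose del : R := lam1 / 2 / M.+1%:R.
have M0 : 0 < M.+1%:R :> R by rewrite ltr0n.
have del0 : 0 < del by rewrite !divr_gt0.
have delM : M.+1%:R * del = lam1 / 2 by rewrite /del mulrC divfK // gt_eqF.
have d16 : 0 < del / 16 by rewrite divr_gt0.
have dk : 0 < del / 4 / kap by rewrite !divr_gt0.
have [S1 h1] := app _ d16; have [S2 h2] := app' _ d16.
have [X0 hX] := lnln_dense (maxn S1 S2) dk.
have /choice[t ht] : forall r : nat, exists t, [/\ rec t, (maxn S1 S2 <= t)%N &
    X0 + r%:R * (del / kap) <= ln (ln (t%:R : R)) <= X0 + r%:R * (del / kap) + del / 4 / kap].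
  move=> r; apply: hX; rewrite lerDl mulr_ge0 // divr_ge0 // ltW //.
have [i [j [ij jM E]]] := pigeonhole (fun i => (lab (t i), lab' (t i))).
have [E1 E2] := (congr1 fst E, congr1 snd E); rewrite /= in E1 E2.
have [ri] := ht i; rewrite geq_max => /andP[Si1 Si2] /andP[bi1 bi2].
have [rj] := ht j; rewrite geq_max => /andP[Sj1 Sj2] /andP[bj1 bj2].
have := h1 _ Si1 ri; have := h2 _ Si2 ri; have := h1 _ Sj1 rj; have := h2 _ Sj2 rj.
rewrite -E1 -E2.
set yi := ln (ln (t i)%:R) in bi1 bi2 *; set yj := ln (ln (t j)%:R) in bj1 bj2 *.
pose z : int := ((l * num (t j))%:Z - (k * num' (t j))%:Z) - ((l * num (t i))%:Z - (k * num' (t i))%:Z).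
have zE : (num (t j))%:R * lam - (num' (t j))%:R * lam' -
    ((num (t i))%:R * lam - (num' (t i))%:R * lam') = z%:~R * lam1.
  by rewrite El Ek /z !rmorphB /= -!pmulrn !natrM; ring.
have kd : kap * (yj - yi) = d'%:R * yj - d%:R * yj - (d'%:R * yi - d%:R * yi).
  by rewrite kapE; ring.
have kdk (r : nat) : kap * (r%:R * (del / kap)) = r%:R * del.
  by rewrite mulrCA [kap * _]mulrC divfK // gt_eqF.
have kdk4 : kap * (del / 4 / kap) = del / 4 by rewrite mulrC divfK // gt_eqF.
have scale x y : x <= y -> kap * x <= kap * y by move=> xy; rewrite ler_wpM2l // ltW.
have /scale := bi1; have /scale := bi2; have /scale := bj1; have /scale := bj2.
rewrite !mulrDr !kdk kdk4 => c1 c2 c3 c4.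
have ijd : i%:R * del + del <= j%:R * del.
  by rewrite -[X in _ + X]mul1r -mulrDl natr1 ler_wpM2r ?(ltW del0) // ler_nat.
have jd : j%:R * del <= lam1 / 2.
  by rewrite -delM ler_wpM2r ?(ltW del0) // ler_nat; exact: leq_trans jM (leqnSn _).
have i0 : 0 <= i%:R * del by rewrite mulr_ge0 // ltW.
have dl : del <= lam1 / 2 by lra.
rewrite !ler_norml => /andP[g1 g2] /andP[g3 g4] /andP[g5 g6] /andP[g7 g8].
have zlo : kap * (yj - yi) - del / 4 <= z%:~R * lam1 by rewrite -zE kd; lra.
have zhi : z%:~R * lam1 <= kap * (yj - yi) + del / 4 by rewrite -zE kd; lra.
rewrite mulrBr in zlo zhi.
have zpos : 0 < z%:~R * lam1 by lra.
have zlt : z%:~R * lam1 < lam1 by lra.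
rewrite pmulr_lgt0 // ltr0z in zpos.
have : (1 : R) <= z%:~R by rewrite ler1z.
move=> z1; have := ler_wpM2r (ltW lam10) z1; rewrite mul1r; lra.
Qed.

End TwoLabellings.
End LogarithmicScale.

(** * Passing to a power of the substitution *)

Section Powers.

(** The sequence is eventually periodic; [p] is a multiple of the period [j - i] beyond the
    preperiod [i]. *)
Lemma idempotent_iterate (T : finType) (f : nat -> T) :
  (forall m n, f m = f n -> f m.+1 = f n.+1) -> exists2 p, (0 < p)%N & f (p + p)%N = f p.
Proof.
move=> fS; have [i [j [ij _ E]]] := pigeonhole f.
have fD k m n : f m = f n -> f (m + k)%N = f (n + k)%N.
  by move=> h; elim: k => [|k IH]; rewrite ?addn0 // !addnS; apply: fS.
have per r m : (i <= m)%N -> f (m + r * (j - i))%N = f m.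
  move=> im; elim: r => [|r IH]; first by rewrite mul0n addn0.
  have -> : (m + r.+1 * (j - i) = j + (m - i + r * (j - i)))%N by rewrite mulSn; lia.
  rewrite -(fD _ _ _ E); have -> : (i + (m - i + r * (j - i)) = m + r * (j - i))%N by lia.
  exact: IH.
exists (i.+1 * (j - i))%N; first by rewrite muln_gt0 /= subn_gt0.
by apply: per; apply: leq_trans (leqnSn i) _; rewrite leq_pmulr // subn_gt0.
Qed.

Lemma mem_morph (A : eqType) (s : A -> seq A) (b : A) w :
  (b \in morph s w) = has (fun a => b \in s a) w.
Proof. by elim: w => //= a w IH; rewrite morph_cons mem_cat IH. Qed.

Lemma letters_idempotent (A : finType) (s : A -> seq A) : exists2 p, (0 < p)%N &
  forall a, iter (p + p) (morph s) [:: a] =i iter p (morph s) [:: a].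
Proof.
pose f n := [ffun ab : A * A => ab.2 \in iter n (morph s) [:: ab.1]].
have [|p p0 E] := @idempotent_iterate _ f.
  move=> m n /ffunP E; apply/ffunP => -[a b]; rewrite !ffunE /= !mem_morph.
  apply: eq_has_r => c; have := E (a, c); rewrite !ffunE /=; exact.
by exists p => // a b; have /ffunP/(_ (a, b)) := E; rewrite !ffunE.
Qed.

Section PowerOfSubstitution.
Variables (A : finType) (s : A -> seq A) (p : nat).
Hypothesis p0 : (0 < p)%N.
Let sp a := iter p (morph s) [:: a].

Lemma morph_power w : morph sp w = iter p (morph s) w.
Proof. by rewrite iter_morphE. Qed.

Lemma iter_morph_power n w : iter n (morph sp) w = iter (n * p) (morph s) w.
Proof. by elim: n => // n IH; rewrite iterS IH morph_power mulSn iterD. Qed.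

Lemma growth_type_power (R : realType) a d (alpha : R) :
  letter_growth_type s a d alpha -> letter_growth_type sp a d (alpha ^+ p).
Proof.
move=> [h1 [c1 [c2 [c10 c20 [N _ hN]]]]]; split; first exact: exprn_ege1.
have pd : 0 < p%:R ^+ d :> R by rewrite exprn_gt0 // ltr0n.
exists (c1 * p%:R ^+ d), (c2 * p%:R ^+ d); split; rewrite ?mulr_gt0 //.
exists N => // n /= Nn; rewrite iter_morph_power.
have Nnp : (N <= n * p)%N by apply: leq_trans Nn _; rewrite leq_pmulr.
have := hN _ Nnp; rewrite natrM exprMn [(n * p)%N]mulnC exprM.
have E c : c * p%:R ^+ d * (n%:R ^+ d * alpha ^+ p ^+ n) =
  c * (n%:R ^+ d * p%:R ^+ d * alpha ^+ p ^+ n) by ring.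
by rewrite !E [(p * n)%N]mulnC.
Qed.

End PowerOfSubstitution.
End Powers.

(** The power [sp] keeps the fixed point and the degrees and raises the rates to the power [p].
    Idempotence of its sets of letters yields both the transitivity [sptr] and the stability
    [hasK]. *)
Lemma substitutive_records (R : realType) (C : finType) (D : nat) (Theta : R)
    (x : nat -> C) (c : C) : (0 < D)%N -> 1 <= Theta -> substitutive D Theta x ->
  (forall n, exists2 k, (n <= k)%N & x k == c) ->
  (forall l, exists t, free (fun k => x k == c) t l) ->
  exists p, [/\ (0 < p)%N,
    exists lam : R, steps_bounded (record (fun k => x k == c)) lam,
    Theta = 1 -> steps_vanishing R (record (fun k => x k == c)) &
    1 < Theta -> exp_poly_positions (record (fun k => x k == c)) D (Theta ^+ p)].
Proof.
move=> D0 T1 [A [s [y [phi [_ hne [d [al [hg hal hd [b [b1 b2]]]]] [[hfix _] hprop] hx]]]]].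
have -> : (fun k => x k == c) = (fun k => phi (y k) == c).
  by apply/funext => k; rewrite hx.
move=> Xinf Xgap.
have {}Xinf n : exists2 k, (n <= k)%N & phi (y k) == c.
  by have [k nk xk] := Xinf n; exists k; rewrite -?hx.
have [p p0 hp] := letters_idempotent s.
pose sp a := iter p (morph s) [:: a]; pose P a := phi a == c; pose K a := has P (sp a).
have spne : nonerasing sp by apply: nonerasing_iter.
have spfix n : morph sp (mkseq y n) = mkseq y (size (morph sp (mkseq y n))).
  by rewrite !morph_power (iter_morph_prefix hfix) size_mkseq.
have sp2 a : morph sp (sp a) =i sp a.
  by move=> e; have := hp a e; rewrite iterD (morph_power s p (sp a)).
have sptr a e f : e \in sp a -> f \in sp e -> f \in sp a.
  by move=> ea fe; rewrite -sp2 mem_morph; apply/hasP; exists e.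
have hasK a : has K (sp a) = K a.
  rewrite [RHS]/K -[in RHS](eq_has_r (sp2 a)).
  by elim: (sp a) => //= e w IH; rewrite morph_cons has_cat -IH.
have hasP a : has P (sp a) = K a by [].
have hgp a := growth_type_power p0 (hg a).
have T0 : 0 < Theta by apply: lt_le_trans T1.
have Tp1 : 1 <= Theta ^+ p by rewrite exprn_ege1.
have Tp0 : 0 < Theta ^+ p by rewrite exprn_gt0.
have letters a : exists l : R, (size (iter n (morph sp) [:: a]))%:R /
    ('C(n, D)%:R * (Theta ^+ p) ^+ n) @[n --> \oo] --> l.
  apply: (letter_cvg sptr hgp Tp0).
  have := hal a; rewrite le_eqVlt => /orP[/eqP E|lt]; first by right; rewrite E; split => //; apply: hd.
  left; rewrite ltrXn2r ?lt0n_neq0 //.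
  by case: (hg a) => h _; apply: le_trans h.
(* The letter [b] attains the growth type of the substitution, and occurs in [y] because [y] is
   proper. *)
have [i0 hi0] := hprop b.
have top : exists2 l : R, 0 < l & (size (iter n (morph sp) [:: y i0]))%:R /
    ('C(n, D)%:R * (Theta ^+ p) ^+ n) @[n --> \oo] --> l.
  by have [l l0 hl] := letter_cvg_gt0 sptr hgp b; exists l => //; rewrite hi0 -b1 -b2.
exists p; split => //.
- exact: (@records_steps R A sp y spne spfix P K hasK hasP Xinf Xgap D _ D0 Tp1 i0 top).
- move=> E; have E' : Theta ^+ p = 1 by rewrite E expr1n.
  exact: (@records_steps_vanishing R A sp y spne spfix P K hasK hasP Xinf Xgap D _ D0 Tp1 letters i0 top E').
- move=> lt; have lt' : 1 < Theta ^+ p by rewrite exprn_egt1 // lt0n_neq0.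
  exact: (@records_positions R A sp y spne spfix P K hasK hasP Xinf D _ D0 Tp1 letters i0 top lt').
Qed.

Lemma infinite_occurrences (C : finType) (x : nat -> C) (c : C) :
  infinite_set [set n | x n = c] -> forall n, exists2 k, (n <= k)%N & x k == c.
Proof.
move=> inf n; apply: contrapT => no; apply: inf.
apply: (@sub_finite_set _ _ `I_n) (finite_II n) => k /= xk.
by rewrite ltnNge; apply/negP => nk; apply: no; exists k => //; apply/eqP.
Qed.

Lemma unbounded_gaps_free (C : finType) (x : nat -> C) (c : C) :
  ~ bounded_gaps x c -> forall l, exists t, free (fun k => x k == c) t l.
Proof.
move=> unb l; apply: contrapT => no; apply: unb; exists l => i j [ij xi xj h].
rewrite leqNgt; apply/negP => lij; apply: no; exists i.+1 => k hk.
by apply/eqP; apply: h; lia.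
Qed.

Theorem theorem17 (R : realType) (d e : nat) (alpha beta : R)
    (hd : d <> 0%N) (he : e <> 0%N) (halpha : 1 <= alpha) (hbeta : 1 <= beta)
    (hneq : (d, alpha) <> (e, beta))
    (hcond :
      mult_independent alpha beta
      \/ [/\ 1 < alpha, 1 < beta & d <> e]
      \/ ((alpha, beta) <> (1, 1)
          /\ ((beta = 1 /\ e <> 0%N) \/ (alpha = 1 /\ d <> 0%N))))
    (C : finType) (x : nat -> C)
    (hx1 : substitutive d alpha x) (hx2 : substitutive e beta x) :
  forall c : C, infinite_set [set n | x n = c] -> bounded_gaps x c.
Proof.
move=> c /infinite_occurrences Xinf; apply: contrapT => /unbounded_gaps_free Xgap.
have d0 : (0 < d)%N by rewrite lt0n; apply/eqP.
have e0 : (0 < e)%N by rewrite lt0n; apply/eqP.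
have [p [p0 [lam0 /steps_bounded_ge1[lam lam1 steps]] vana posa]] :=
  substitutive_records d0 halpha hx1 Xinf Xgap.
have [q [q0 _ vanb posb]] := substitutive_records e0 hbeta hx2 Xinf Xgap.
have unb := record_unbounded Xinf Xgap.
have lnX (z : R) n : 1 < z -> (0 < n)%N -> 1 < z ^+ n /\ 0 < ln (z ^+ n).
  by move=> z1 n0; have h : 1 < z ^+ n; [rewrite exprn_egt1 // lt0n_neq0|split=> //; apply: ln_gt0].
(* Both rates equal to 1 is excluded by each of the three conditions; if exactly one is 1, quotients
   tending to 1 contradict the labelling given by the other. *)
case: (eqVneq alpha 1) => [a1|an1]; case: (eqVneq beta 1) => [b1|bn1].
- case: hcond => [/(_ 1%N 1%N)|[[]|[]]]; last by rewrite a1 b1.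
    by rewrite a1 b1 => /(_ erefl) [].
  by rewrite a1 ltxx.
- have b1 : 1 < beta by rewrite lt_neqAle eq_sym bn1.
  have [bq lq] := lnX _ _ b1 q0.
  have [T [f [lab [num [S0 hl]]]]] := positions_labelled bq (posb b1).
  exact: (vanishing_vs_labelled unb lq (vana a1) hl).
- have a1 : 1 < alpha by rewrite lt_neqAle eq_sym an1.
  have [ap lp] := lnX _ _ a1 p0.
  have [T [f [lab [num [S0 hl]]]]] := positions_labelled ap (posa a1).
  exact: (vanishing_vs_labelled unb lp (vanb b1) hl).
have a1 : 1 < alpha by rewrite lt_neqAle eq_sym an1.
have b1 : 1 < beta by rewrite lt_neqAle eq_sym bn1.
have [ap lp] := lnX _ _ a1 p0; have [bq lq] := lnX _ _ b1 q0.
have [T [f [lab [num [S0 hl]]]]] := positions_labelled ap (posa a1).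
have [T' [f' [lab' [num' [S0' hl']]]]] := positions_labelled bq (posb b1).
have [k [l [k0 l0 E]]] := labelled_dependent unb steps lam1 hl hl' lp lq.
have l0R : 0 < l%:R :> R by rewrite ltr0n.
(* By [E], this quotient is a common unit of the two logarithmic rates, which are [l] and [k] times
   it. *)
have ln0 : 0 < ln (alpha ^+ p) / l%:R by rewrite divr_gt0.
have E1 : ln (alpha ^+ p) = l%:R * (ln (alpha ^+ p) / l%:R).
  by rewrite mulrC divfK // gt_eqF.
have E2 : ln (beta ^+ q) = k%:R * (ln (alpha ^+ p) / l%:R).
  by rewrite mulrA E mulrAC divff ?mul1r // gt_eqF.
case: hcond => [ind|[[_ _ de]|[_ [[b1' _]|[a1' _]]]]].
- have a0 : 0 < alpha by apply: lt_trans a1.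
  have b0 : 0 < beta by apply: lt_trans b1.
  have : alpha ^+ (p * k) = beta ^+ (q * l).
    apply: ln_inj; rewrite ?posrE ?exprn_gt0 //.
    by rewrite !exprM lnXn ?exprn_gt0 // [RHS]lnXn ?exprn_gt0 // -[LHS]mulr_natl -[RHS]mulr_natl.
  by case/ind => /eqP; rewrite muln_eq0 eqn0Ngt ?p0 ?q0 eqn0Ngt ?k0 ?l0.
- case: (ltngtP d e) => [de'|de'|//].
    exact: (labelled_same_degree unb steps lam1 hl hl' ln0 E1 E2 de').
  exact: (labelled_same_degree unb steps lam1 hl' hl ln0 E2 E1 de').
- by rewrite b1' ltxx in b1.
- by rewrite a1' ltxx in a1.
Qed.
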